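(* For all $z\in\mathbb{C}$ with $\operatorname{Re}z>0$, $$\frac{W(z)}{z}=\frac{2}{\pi}\int_0^{\pi/2}\frac{\left[v^2+(1+v\tan v)^2\right]v\sec(v)\,e^{v\tan v}}{z^2+v^2\sec^2(v)\,e^{2v\tan v}}\,\tan v\,dv .$$
   Context: $W$ denotes the principal branch of the Lambert $W$ function: the unique holomorphic function on $\mathbb{C}\setminus(-\infty,-1/e]$ with $W(z)e^{W(z)}=z$ and $W(0)=0$. *)

(* Defs.v *)
From Stdlib Require Import Reals.
From Coquelicot Require Import Coquelicot.
Open Scope R_scope.

Definition Cexp (z : C) : C := (exp (Re z) * cos (Im z), exp (Re z) * sin (Im z)).

Definition slit_plane (z : C) : Prop := ~ (Im z = 0 /\ Re z <= - / exp 1).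

(* The principal branch is used through its defining property, as a function
   on all of C whose values on the cut are left unconstrained. The slit plane
   is open, so holomorphy there is complex differentiability at each point. *)
Definition is_principal_LambertW (W : C -> C) : Prop :=
  (forall z : C, slit_plane z -> ex_derive (K := C_AbsRing) (V := C_NormedModule) W z) /\
  (forall z : C, slit_plane z -> (W z * Cexp (W z))%C = z) /\
  W (RtoC 0) = RtoC 0.

Definition sec (v : R) : R := / cos v.

(* Since cos (PI / 2) = 0, the value at v = PI / 2 is an artefact of totalised
   inversion; a single point does not affect the Riemann integral. *)
Definition LambertW_integrand (z : C) (v : R) : C :=
  (RtoC ((v ^ 2 + (1 + v * tan v) ^ 2) * v * sec v * exp (v * tan v))
   / (z ^ 2 + RtoC (v ^ 2 * sec v ^ 2 * exp (2 * v * tan v)))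
   * RtoC (tan v))%C.

(* Main.v *)
Require Import Defs.
From Stdlib Require Import Reals Lra.
From Coquelicot Require Import Coquelicot.
Open Scope R_scope.

(** The formula is Cauchy's integral formula for a half-plane, read along the
    parametrisation of the imaginary axis that makes [W] explicit.

    Put [h w = W w / (w + z)], which is holomorphic on a neighbourhood of the
    closed right half-plane and decays there, since [|W w|^2 <= 2 |w|].
    Cauchy's formula on half-discs of growing radius gives the limit
    [PI * W z / z] for the integral of [W (i y) / (z^2 + y^2)] over [[-r, r]]
    ([LambertW_imag_integral]).  The equation [w e^w = i y] with
    [|Im w| < PI / 2] forces [w = v tan v + i v] and [y = v sec v e^(v tan v)]
    ([LambertW_imag_axis]), so that [v] is a coordinate on the imaginary axis in
    which [W] is elementary.  Substituting it and adding the contributions of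
    [v] and [-v], whose parts odd in [v] cancel, yields twice the integral over
    [[0, v]] of the integrand of the theorem ([LambertW_fold]), whose factor
    [v^2 + (1 + v tan v)^2] comes from [dy/dv].  Finally [v] tends to [PI / 2],
    where the integrand tends to [0].

    Cauchy's formula is proved on open sets star-shaped around [z], by shrinking
    paths radially to [z] ([cauchy_path_independence]).  After the substitution
    [w = z + s (g t - z)] the kernel [g' / (g - z)] no longer depends on [s];
    the derivative in [s] of the integral of [h] against it is the integral of
    an exact derivative, hence depends only on the end points of the path.  Two
    paths with the same end points thus give integrals of [h - h z] against the
    kernel that have the same derivative in [s], and both vanish at [s = 0].
    Applied to a diameter and to a half-circle, this leaves two kernel integrals
    to estimate, which tend to [- i PI] and [i PI]; their difference is the
    factor [2 i PI] of the residue theorem.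

    The branch is identified by continuity along rays: at a point [w] with
    [Im w = PI / 2] or [Im w = - PI / 2] the real part of [w e^w] is negative,
    so [W], which starts from [0], maps the closed right half-plane into the
    strip [|Im w| < PI / 2]. *)

(** * Complex and path derivatives *)

(** [C] is a normed module over two fields: functions of a complex variable are
    differentiated over [C], paths and integrals over [R]. *)
Local Notation is_Cderive := (is_derive (K := C_AbsRing) (V := C_NormedModule)).
Local Notation is_path_derive := (is_derive (K := R_AbsRing) (V := C_R_NormedModule)).
Local Notation Ccontinuous f := (continuous (U := C_UniformSpace) f).
Local Notation Ccontinuous_map f :=
  (continuous (T := C_UniformSpace) (U := C_UniformSpace) f).
Local Notation R2 := (prod_UniformSpace R_UniformSpace R_UniformSpace).

Lemma Cmult_cancel_l (c x y : C) : c <> 0 -> (c * x = c * y)%C -> x = y.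
Proof.
  intros Hc E. replace x with (/ c * (c * x))%C by (field; exact Hc).
  rewrite E. field. exact Hc.
Qed.

Lemma im_le_Cmod (z : C) : Rabs (Im z) <= Cmod z.
Proof. eapply Rle_trans; [apply Rmax_r | apply Rmax_Cmod]. Qed.

Lemma Cmod_le_abs (z : C) : Cmod z <= Rabs (fst z) + Rabs (snd z).
Proof.
  destruct z as [x y]. simpl.
  replace ((x, y) : C) with (RtoC x + Ci * RtoC y)%C
    by (apply injective_projections; simpl; ring).
  eapply Rle_trans; [apply Cmod_triangle|].
  rewrite Cmod_mult, Cmod_Ci, !Cmod_R. lra.
Qed.

Lemma Cmod_minus_ge (w z : C) : Cmod w - Cmod z <= Cmod (w - z).
Proof.
  generalize (Cmod_triangle (w - z) z).
  replace (w - z + z)%C with w by ring. lra.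
Qed.

Lemma Cmod_plus_ge (w z : C) : Cmod w - Cmod z <= Cmod (w + z).
Proof.
  generalize (Cmod_minus_ge w (- z)). rewrite Cmod_opp.
  replace (w - - z)%C with (w + z)%C by ring. easy.
Qed.

(** The field structure of [C] is declared for the type [C] itself, so an equality
    in the carrier of a normed module on [C] has to be restated there. *)
Ltac Ceq := match goal with |- @eq _ ?a ?b => change (@eq C a b) end; cbv beta.

Lemma is_Cderive_eps (h : C -> C) (z l : C) :
  is_Cderive h z l <->
  forall eps : posreal, exists delta : posreal, forall y : C,
    Cmod (y - z) < delta -> Cmod (h y - h z - l * (y - z)) <= eps * Cmod (y - z).
Proof.
  split.
  - intros [_ H] eps.
    destruct (H z (fun P H => H) eps) as [d Hd].
    exists d. intros y Hy.
    specialize (Hd y Hy).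
    change (Cmod (h y - h z - (y - z) * l) <= eps * Cmod (y - z)) in Hd.
    now rewrite (Cmult_comm l).
  - intros H. split.
    + apply (is_linear_scal_l (K := C_AbsRing) (V := C_NormedModule)).
    + intros x Hx.
      assert (Hx' : z = x) by (apply (is_filter_lim_locally_unique (K := C_AbsRing)
          (V := AbsRing_NormedModule C_AbsRing)); exact Hx).
      subst x. intros eps.
      destruct (H eps) as [d Hd].
      exists d. intros y Hy.
      change (Cmod (h y - h z - (y - z) * l) <= eps * Cmod (y - z)).
      rewrite (Cmult_comm _ l). now apply Hd.
Qed.

Lemma is_linear_Cmult (l : C) :
  is_linear (K := R_AbsRing) (U := C_R_NormedModule) (V := C_R_NormedModule)
    (fun y => l * y)%C.
Proof.
  split.
  - intros x y. apply Cmult_plus_distr_l.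
  - intros k x. rewrite !scal_R_Cmult. Ceq. ring.
  - exists (Cmod l + 1). split.
    + generalize (Cmod_ge_0 l); lra.
    + intros x. rewrite <- !Cmod_norm, Cmod_mult.
      generalize (Cmod_ge_0 l) (Cmod_ge_0 x); nra.
Qed.

(** Complex differentiability is real differentiability with a [C]-linear
    differential.  This and its converse [filterdiff_is_Cderive] carry the chain
    rule from functions of a complex variable to paths, and real partial
    derivatives to complex ones. *)
Lemma is_Cderive_filterdiff (h : C -> C) (z l : C) :
  is_Cderive h z l ->
  filterdiff (K := R_AbsRing) (U := C_R_NormedModule) (V := C_R_NormedModule)
    h (locally z) (fun y => l * y)%C.
Proof.
  intros H. pose proof (proj1 (is_Cderive_eps h z l) H) as H'. split.
  - apply is_linear_Cmult.
  - intros x Hx.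
    assert (Hx' : z = x) by (apply (is_filter_lim_locally_unique (K := R_AbsRing)
        (V := C_R_NormedModule)); exact Hx).
    subst x. intros eps.
    destruct (H' eps) as [d Hd].
    apply locally_C. exists d. intros y Hy.
    rewrite <- !Cmod_norm.
    apply (Hd y Hy).
Qed.

Lemma filterdiff_is_Cderive (h : C -> C) (z l : C) :
  filterdiff (K := R_AbsRing) (U := C_R_NormedModule) (V := C_R_NormedModule)
    h (locally z) (fun y => l * y)%C ->
  is_Cderive h z l.
Proof.
  intros [_ H]. apply is_Cderive_eps. intros eps.
  specialize (H z (fun P H => H) eps). apply locally_C in H. destruct H as [d Hd].
  exists d. intros y Hy. specialize (Hd y Hy). now rewrite <- !Cmod_norm in Hd.
Qed.

Lemma is_Cderive_continuous (h : C -> C) (z l : C) :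
  is_Cderive h z l -> Ccontinuous_map h z.
Proof.
  intros H. apply is_Cderive_filterdiff in H.
  apply (filterdiff_continuous (K := R_AbsRing) (U := C_R_NormedModule) (V := C_R_NormedModule)).
  eexists; exact H.
Qed.

Lemma is_Cderive_unique (f : C -> C) (z l1 l2 : C) :
  is_Cderive f z l1 -> is_Cderive f z l2 -> l1 = l2.
Proof.
  intros H1 H2. apply is_C_derive_unique in H1, H2. now rewrite <- H1, <- H2.
Qed.

Lemma is_Cderive_mult (f g : C -> C) (z df dg : C) :
  is_Cderive f z df -> is_Cderive g z dg ->
  is_Cderive (fun w => f w * g w)%C z (df * g z + f z * dg)%C.
Proof.
  intros [_ Hf] [_ Hg].
  set (L := is_linear_scal_l (K := C_AbsRing) (V := AbsRing_NormedModule C_AbsRing)).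
  destruct (is_derive_mult (K := C_AbsRing) f g z df dg (conj (L df) Hf) (conj (L dg) Hg) Cmult_comm)
    as [_ H].
  split; [apply (is_linear_scal_l (K := C_AbsRing) (V := C_NormedModule)) | exact H].
Qed.

Lemma is_Cderive_comp (f g : C -> C) (z df dg : C) :
  is_Cderive f (g z) df -> is_Cderive g z dg -> is_Cderive (fun w => f (g w)) z (dg * df)%C.
Proof.
  intros Hf [_ Hg]. apply (is_derive_comp (K := C_AbsRing) (V := C_NormedModule)); [exact Hf|].
  split; [apply is_linear_scal_l | exact Hg].
Qed.

Lemma is_Cderive_affine (c d x : C) : is_Cderive (fun w => c * w + d)%C x c.
Proof.
  apply is_Cderive_eps. intros eps. exists eps. intros y _.
  replace (c * y + d - (c * x + d) - c * (y - x))%C with (RtoC 0) by ring.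
  rewrite Cmod_0. generalize (Cmod_ge_0 (y - x)) (cond_pos eps). nra.
Qed.

Lemma is_Cderive_inv (z : C) : z <> 0 -> is_Cderive Cinv z (- / (z * z))%C.
Proof.
  intros Hz. apply is_Cderive_eps. intros eps.
  assert (P : 0 < Cmod z) by now apply Cmod_gt_0.
  set (m := Cmod z) in *.
  assert (Hd : 0 < Rmin (m / 2) (eps * m ^ 3 / 2)).
  { generalize (cond_pos eps) (pow_lt m 3 P). intros E M. apply Rmin_pos; nra. }
  exists (mkposreal _ Hd). intros y Hy. simpl in Hy.
  assert (H1 := Rlt_le_trans _ _ _ Hy (Rmin_l _ _)).
  assert (H2 := Rlt_le_trans _ _ _ Hy (Rmin_r _ _)). clear Hy Hd.
  assert (Hym : m / 2 <= Cmod y).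
  { generalize (Cmod_minus_ge z (z - y)).
    replace (z - (z - y))%C with y by ring.
    rewrite <- (Copp_minus_distr y z), Cmod_opp. fold m. lra. }
  assert (Hy0 : y <> 0) by (apply Cmod_gt_0; lra).
  replace (/ y - / z - - / (z * z) * (y - z))%C
    with ((y - z) * (y - z) / (z * z * y))%C by (field; auto).
  rewrite Cmod_div by (repeat apply Cmult_neq_0; auto).
  rewrite !Cmod_mult. fold m.
  apply Rle_div_l; [apply Rmult_lt_0_compat; nra|].
  assert (Hc : Cmod (y - z) <= eps * (m * m * Cmod y)).
  { apply Rle_trans with (eps * (m * m * (m / 2))); [lra|].
    apply Rmult_le_compat_l; [apply Rlt_le, cond_pos|].
    apply Rmult_le_compat_l; nra. }
  generalize (Cmod_ge_0 (y - z)). nra.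
Qed.

Lemma is_path_derive_comp (h : C -> C) (p : R -> C) (t : R) (l dp : C) :
  is_Cderive h (p t) l -> is_path_derive p t dp ->
  is_path_derive (fun s => h (p s)) t (l * dp)%C.
Proof.
  intros Hh Hp. apply is_Cderive_filterdiff in Hh.
  eapply filterdiff_ext_lin.
  - eapply (filterdiff_comp' (U := AbsRing_NormedModule R_AbsRing) (V := C_R_NormedModule)
      (W := C_R_NormedModule) p h); [exact Hp | exact Hh].
  - intros y. simpl. rewrite !scal_R_Cmult. Ceq. ring.
Qed.

Lemma is_path_derive_pair (f : R -> C) (t : R) (l : C) :
  is_path_derive f t l <->
  is_derive (fun s => fst (f s)) t (fst l) /\ is_derive (fun s => snd (f s)) t (snd l).
Proof.
  split.
  - intros H. split.
    + eapply filterdiff_ext_lin.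
      * eapply (filterdiff_comp' (U := AbsRing_NormedModule R_AbsRing) (V := C_R_NormedModule)
          (W := R_NormedModule) f fst); [exact H |].
        apply filterdiff_linear, is_linear_fst.
      * intros y. reflexivity.
    + eapply filterdiff_ext_lin.
      * eapply (filterdiff_comp' (U := AbsRing_NormedModule R_AbsRing) (V := C_R_NormedModule)
          (W := R_NormedModule) f snd); [exact H |].
        apply filterdiff_linear, is_linear_snd.
      * intros y. reflexivity.
  - intros [H1 H2].
    apply (filterdiff_ext (U := AbsRing_NormedModule R_AbsRing) (V := C_R_NormedModule)
      (fun s => (fst (f s), snd (f s)))).
    { intros y. now rewrite <- surjective_pairing. }
    eapply filterdiff_ext_lin.
    + apply (filterdiff_comp'_2 (T := AbsRing_NormedModule R_AbsRing) (U := R_NormedModule)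
       (V := R_NormedModule) (W := C_R_NormedModule)
       (fun s => fst (f s)) (fun s => snd (f s)) (fun a b => (a, b)) t _ _ (fun a b => (a,b)) H1 H2).
      apply filterdiff_ext_lin with (fun u => u); [| now intros []].
      apply (filterdiff_ext (U := C_R_NormedModule) (V := C_R_NormedModule) (fun u => u)); [now intros []|].
      apply filterdiff_id.
    + intros y. reflexivity.
Qed.

Lemma is_path_derive_RtoC (f : R -> R) (t l : R) :
  is_derive f t l -> is_path_derive (fun s => RtoC (f s)) t (RtoC l).
Proof.
  intros H. apply is_path_derive_pair. split; [exact H|].
  exact (is_derive_const (K := R_AbsRing) (V := R_NormedModule) 0 t).
Qed.

Lemma is_path_derive_affine (c d : C) (f : R -> C) (t : R) (l : C) :
  is_path_derive f t l -> is_path_derive (fun s => c * f s + d)%C t (c * l)%C.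
Proof.
  apply (is_path_derive_comp (fun w => c * w + d)%C), is_Cderive_affine.
Qed.

Lemma path_continuous (g dg : R -> C) (t : R) :
  is_path_derive g t (dg t) -> Ccontinuous g t.
Proof.
  intros H. apply (ex_derive_continuous (V := C_R_NormedModule)). now exists (dg t).
Qed.

(** * Continuity of complex-valued functions *)

Lemma Ccontinuous_pair {U : UniformSpace} (f : U -> C) (x : U) :
  Ccontinuous f x <->
  continuous (fun u => fst (f u)) x /\ continuous (fun u => snd (f u)) x.
Proof.
  split.
  - intros H. split.
    + apply (continuous_comp (V := C_UniformSpace) f fst); [exact H|].
      destruct (f x). apply continuous_fst.
    + apply (continuous_comp (V := C_UniformSpace) f snd); [exact H|].
      destruct (f x). apply continuous_snd.
  - intros [H1 H2]. apply filterlim_locally. intros eps.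
    generalize (filter_and _ _ (proj1 (filterlim_locally _ _) H1 eps)
      (proj1 (filterlim_locally _ _) H2 eps)).
    apply filter_imp. intros y []. now split.
Qed.

Lemma Ccontinuous_mult {U : UniformSpace} (f g : U -> C) (x : U) :
  Ccontinuous f x -> Ccontinuous g x -> Ccontinuous (fun u => f u * g u)%C x.
Proof.
  intros Hf Hg. apply Ccontinuous_pair in Hf as [F1 F2]. apply Ccontinuous_pair in Hg as [G1 G2].
  apply Ccontinuous_pair. split; simpl.
  - apply (continuous_minus (V := R_NormedModule)); now apply (continuous_mult (K := R_AbsRing)).
  - apply (continuous_plus (V := R_NormedModule)); now apply (continuous_mult (K := R_AbsRing)).
Qed.

Lemma Ccontinuous_plus {U : UniformSpace} (f g : U -> C) (x : U) :
  Ccontinuous f x -> Ccontinuous g x -> Ccontinuous (fun u => f u + g u)%C x.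
Proof. apply (continuous_plus (V := C_R_NormedModule)). Qed.

Lemma Ccontinuous_opp {U : UniformSpace} (f : U -> C) (x : U) :
  Ccontinuous f x -> Ccontinuous (fun u => - f u)%C x.
Proof. apply (continuous_opp (V := C_R_NormedModule)). Qed.

Lemma Ccontinuous_minus {U : UniformSpace} (f g : U -> C) (x : U) :
  Ccontinuous f x -> Ccontinuous g x -> Ccontinuous (fun u => f u - g u)%C x.
Proof. apply (continuous_minus (V := C_R_NormedModule)). Qed.

Lemma Ccontinuous_RtoC {U : UniformSpace} (f : U -> R) (x : U) :
  continuous f x -> Ccontinuous (fun u => RtoC (f u)) x.
Proof.
  intros H. apply Ccontinuous_pair. split; [exact H | apply continuous_const].
Qed.

Lemma Cnorm_sqr_neq_0 (z : C) : z <> 0 -> fst z ^ 2 + snd z ^ 2 <> 0.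
Proof.
  destruct z as [a b]. simpl. intros H E. apply H.
  assert (a = 0) by nra. assert (b = 0) by nra. now subst.
Qed.

Lemma Ccontinuous_inv {U : UniformSpace} (f : U -> C) (x : U) :
  Ccontinuous f x -> f x <> 0 -> Ccontinuous (fun u => / f u)%C x.
Proof.
  intros Hf H0. apply Cnorm_sqr_neq_0 in H0. apply Ccontinuous_pair in Hf as [F1 F2].
  assert (D : continuous (fun u => / (fst (f u) ^ 2 + snd (f u) ^ 2)) x).
  { apply (continuous_comp (V := R_UniformSpace) _ (fun r => / r));
      [| now apply continuous_Rinv].
    apply (continuous_plus (V := R_NormedModule)).
    - apply (continuous_comp (V := R_UniformSpace) (fun u => fst (f u)) (fun r => r ^ 2)); [exact F1|].
      apply (ex_derive_continuous (V := R_NormedModule)). auto_derive; auto.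
    - apply (continuous_comp (V := R_UniformSpace) (fun u => snd (f u)) (fun r => r ^ 2)); [exact F2|].
      apply (ex_derive_continuous (V := R_NormedModule)). auto_derive; auto. }
  apply Ccontinuous_pair. split; simpl; unfold Rdiv; simpl in D.
  - now apply (continuous_mult (K := R_AbsRing)).
  - apply (continuous_mult (K := R_AbsRing)); [|exact D].
    now apply (continuous_opp (V := R_NormedModule)).
Qed.

Lemma locally_Cneq (w z : C) : w <> z -> locally (T := C_UniformSpace) w (fun y => y <> z).
Proof.
  intros H. apply Cminus_eq_contra, Cmod_gt_0 in H.
  apply locally_C. exists (mkposreal _ H). intros y Hy ->.
  change (Cmod (z - w) < Cmod (w - z)) in Hy.
  rewrite <- Cmod_opp, Copp_minus_distr in Hy. lra.
Qed.

Lemma Cfilterlim_eps {T : Type} (F : (T -> Prop) -> Prop) {FF : Filter F} (f : T -> C) (l : C) :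
  (forall eps, 0 < eps -> F (fun x => Cmod (f x - l) < eps)) ->
  filterlim f F (locally (T := C_UniformSpace) l).
Proof.
  intros H. apply filterlim_locally. intros eps.
  generalize (H eps (cond_pos eps)). apply filter_imp.
  intros x Hx. now apply (C_NormedModule_mixin_compat1 l (f x)).
Qed.

(** * The complex exponential *)

(** The real partial derivatives of [Cexp] are continuous, hence [Cexp] is
    differentiable over [R], and its differential is multiplication by
    [Cexp w]. *)
Lemma is_Cderive_Cexp (w : C) : is_Cderive Cexp w (Cexp w).
Proof.
  destruct w as [x y]. apply filterdiff_is_Cderive.
  assert (F1 := is_derive_filterdiff (fun a b => exp a * cos b) x y
    (fun a b => exp a * cos b) (- (exp x * sin y))).
  assert (F2 := is_derive_filterdiff (fun a b => exp a * sin b) x y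
    (fun a b => exp a * sin b) (exp x * cos y)).
  assert (Cpow : forall f g : R -> R, (forall t, ex_derive f t) -> (forall t, ex_derive g t) ->
    continuous (fun u : R * R => f (fst u) * g (snd u)) (x, y)).
  { intros f g Hf Hg. apply (continuous_mult (K := R_AbsRing)).
    - apply (continuous_comp (U := R2)
        (V := R_UniformSpace) fst f); [apply continuous_fst|].
      apply (ex_derive_continuous (V := R_NormedModule)), Hf.
    - apply (continuous_comp (U := R2)
        (V := R_UniformSpace) snd g); [apply continuous_snd|].
      apply (ex_derive_continuous (V := R_NormedModule)), Hg. }
  specialize (F1 ltac:(apply filter_forall; intros u; auto_derive; auto; ring)
    ltac:(auto_derive; auto; ring)
    (Cpow exp cos ltac:(intros; auto_derive; auto) ltac:(intros; auto_derive; auto))).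
  specialize (F2 ltac:(apply filter_forall; intros u; auto_derive; auto; ring)
    ltac:(auto_derive; auto; ring)
    (Cpow exp sin ltac:(intros; auto_derive; auto) ltac:(intros; auto_derive; auto))).
  eapply filterdiff_ext_lin.
  - apply (filterdiff_comp'_2 (T := C_R_NormedModule) (U := R_NormedModule)
       (V := R_NormedModule) (W := C_R_NormedModule) _ _ (fun a b => (a, b)) (x, y) _ _
       (fun a b => (a, b)) F1 F2).
    apply filterdiff_ext_lin with (fun u => u); [| now intros []].
    apply (filterdiff_ext (U := C_R_NormedModule) (V := C_R_NormedModule) (fun u => u)); [now intros []|].
    apply filterdiff_id.
  - intros [a b]. apply injective_projections; unfold scal, plus, Cexp, Re, Im; simpl;
    unfold mult; simpl; ring.
Qed.

Lemma Cmod_Cexp (w : C) : Cmod (Cexp w) = exp (Re w).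
Proof.
  unfold Cmod, Cexp. cbn [fst snd].
  replace ((exp (Re w) * cos (Im w)) ^ 2 + (exp (Re w) * sin (Im w)) ^ 2)
    with (Rsqr (exp (Re w)) * ((sin (Im w))² + (cos (Im w))²)) by (unfold Rsqr; ring).
  rewrite sin2_cos2, Rmult_1_r. apply sqrt_Rsqr. left. apply exp_pos.
Qed.

Lemma Ccontinuous_Cexp {U : UniformSpace} (f : U -> C) (x : U) :
  Ccontinuous f x -> Ccontinuous (fun u => Cexp (f u)) x.
Proof.
  intros H. apply (continuous_comp (V := C_UniformSpace) f Cexp); [exact H|].
  apply is_Cderive_continuous with (Cexp (f x)), is_Cderive_Cexp.
Qed.

(** * Integrals of complex-valued functions of a real variable *)

Local Notation is_CInt := (is_RInt (V := C_R_NormedModule)).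
Local Notation CInt := (RInt (V := C_R_CompleteNormedModule)).
Local Notation ex_CInt := (ex_RInt (V := C_R_CompleteNormedModule)).

Lemma ex_CInt_continuous (f : R -> C) (a b : R) :
  (forall t, Rmin a b <= t <= Rmax a b -> Ccontinuous f t) -> ex_CInt f a b.
Proof. apply (ex_RInt_continuous (V := C_R_CompleteNormedModule)). Qed.

Lemma CInt_correct (f : R -> C) (a b : R) : ex_CInt f a b -> is_CInt f a b (CInt f a b).
Proof. apply (RInt_correct (V := C_R_CompleteNormedModule)). Qed.

Lemma is_CInt_unique (f : R -> C) (a b : R) (l : C) : is_CInt f a b l -> CInt f a b = l.
Proof. apply (is_RInt_unique (V := C_R_CompleteNormedModule)). Qed.

Lemma is_CInt_pair (f : R -> C) (a b : R) (l : C) :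
  is_CInt f a b l <->
  is_RInt (fun t => fst (f t)) a b (fst l) /\ is_RInt (fun t => snd (f t)) a b (snd l).
Proof.
  split.
  - intros H. split.
    + now apply (is_RInt_fct_extend_fst (U := R_NormedModule) (V := R_NormedModule)).
    + now apply (is_RInt_fct_extend_snd (U := R_NormedModule) (V := R_NormedModule)).
  - intros [H1 H2]. rewrite (surjective_pairing l).
    now apply (is_RInt_fct_extend_pair (U := R_NormedModule) (V := R_NormedModule)).
Qed.

Lemma is_CInt_mult (c : C) (f : R -> C) (a b : R) (l : C) :
  is_CInt f a b l -> is_CInt (fun t => c * f t)%C a b (c * l)%C.
Proof.
  intros H. apply is_CInt_pair in H as [H1 H2]. apply is_CInt_pair. simpl. split.
  - apply (is_RInt_minus (V := R_NormedModule));
      now apply (is_RInt_scal (V := R_NormedModule)).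
  - apply (is_RInt_plus (V := R_NormedModule));
      now apply (is_RInt_scal (V := R_NormedModule)).
Qed.

Lemma CInt_mult (c : C) (f : R -> C) (a b : R) :
  ex_CInt f a b -> CInt (fun t => c * f t)%C a b = (c * CInt f a b)%C.
Proof. intros H. now apply is_CInt_unique, is_CInt_mult, CInt_correct. Qed.

Lemma CInt_ext (f g : R -> C) (a b : R) :
  (forall t, Rmin a b < t < Rmax a b -> f t = g t) -> CInt f a b = CInt g a b.
Proof. apply (RInt_ext (V := C_R_CompleteNormedModule)). Qed.

Lemma Cmod_CInt_le (f : R -> C) (a b M : R) :
  a <= b -> ex_CInt f a b -> (forall t, a <= t <= b -> Cmod (f t) <= M) ->
  Cmod (CInt f a b) <= (b - a) * M.
Proof.
  intros Hab Hf HM. rewrite Cmod_norm.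
  apply (norm_RInt_le (V := C_R_NormedModule) f (fun _ => M) a b).
  - exact Hab.
  - intros t Ht. change (Rle (@norm _ C_R_NormedModule (f t)) M). rewrite <- Cmod_norm. now apply HM.
  - now apply CInt_correct.
  - apply (is_RInt_const (V := R_NormedModule)).
Qed.

(** Differentiability in the parameter is required for all its values, which
    spares the uniformity in [t] of the neighbourhoods that
    [is_derive_RInt_param] asks for. *)
Lemma is_derive_RInt_param_all (f df : R -> R -> R) (a b x : R) :
  (forall t, Rmin a b <= t <= Rmax a b ->
     locally t (fun t' => forall s, is_derive (fun u => f u t') s (df s t'))) ->
  (forall t, Rmin a b <= t <= Rmax a b ->
     continuous (fun p : R * R => df (fst p) (snd p)) (x, t)) ->
  (forall s, ex_RInt (f s) a b) ->
  is_derive (fun s => RInt (f s) a b) x (RInt (df x) a b).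
Proof.
  intros H1 H2 H3.
  assert (E : RInt (df x) a b = RInt (fun t => Derive (fun u => f u t) x) a b).
  { apply RInt_ext. intros t Ht. symmetry. apply is_derive_unique.
    apply (locally_singleton t (fun t' => forall s, is_derive (fun u => f u t') s (df s t'))).
    apply H1. lra. }
  rewrite E. apply is_derive_RInt_param.
  - apply filter_forall. intros s t Ht. exists (df s t).
    now apply (locally_singleton t (fun t' => forall s, is_derive (fun u => f u t') s (df s t'))), H1.
  - intros t Ht. destruct (H1 t Ht) as [d Hd].
    apply continuity_2d_pt_ext_loc with df.
    + exists d. intros u v _ Hv. symmetry. apply is_derive_unique. now apply Hd.
    + apply continuity_2d_pt_filterlim. exact (H2 t Ht).
  - apply filter_forall. intros s. apply H3.
Qed.

Lemma is_path_derive_CInt_param (f df : R -> R -> C) (a b x : R) :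
  (forall t, Rmin a b <= t <= Rmax a b ->
     locally t (fun t' => forall s, is_path_derive (fun u => f u t') s (df s t'))) ->
  (forall t, Rmin a b <= t <= Rmax a b ->
     Ccontinuous (fun p : R * R => df (fst p) (snd p)) (x, t)) ->
  (forall s, ex_CInt (f s) a b) ->
  is_path_derive (fun s => CInt (f s) a b) x (CInt (df x) a b).
Proof.
  intros H1 H2 H3.
  assert (H4 : ex_CInt (df x) a b).
  { apply ex_CInt_continuous. intros t Ht.
    apply (continuous_comp_2 (V := R_UniformSpace) (W := R_UniformSpace) (X := C_UniformSpace)
      (fun _ => x) (fun t => t) df).
    - apply continuous_const.
    - apply continuous_id.
    - now apply H2. }
  assert (I : forall s, is_RInt (fun t => fst (f s t)) a b (fst (CInt (f s) a b)) /\
     is_RInt (fun t => snd (f s t)) a b (snd (CInt (f s) a b)))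
    by (intros s; apply is_CInt_pair, CInt_correct, H3).
  destruct (proj1 (is_CInt_pair _ _ _ _) (CInt_correct _ _ _ H4)) as [J1 J2].
  apply is_path_derive_pair. split.
  - rewrite <- (is_RInt_unique _ _ _ _ J1).
    apply (is_derive_ext (fun s => RInt (fun t => fst (f s t)) a b)).
    { intros s. exact (is_RInt_unique _ _ _ _ (proj1 (I s))). }
    apply (is_derive_RInt_param_all (fun s t => fst (f s t)) (fun s t => fst (df s t))).
    + intros t Ht. generalize (H1 t Ht). apply filter_imp.
      intros t' H s. now apply is_path_derive_pair.
    + intros t Ht. now apply (proj1 (proj1 (Ccontinuous_pair _ _) (H2 t Ht))).
    + intros s. eexists. exact (proj1 (I s)).
  - rewrite <- (is_RInt_unique _ _ _ _ J2).
    apply (is_derive_ext (fun s => RInt (fun t => snd (f s t)) a b)).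
    { intros s. exact (is_RInt_unique _ _ _ _ (proj2 (I s))). }
    apply (is_derive_RInt_param_all (fun s t => snd (f s t)) (fun s t => snd (df s t))).
    + intros t Ht. generalize (H1 t Ht). apply filter_imp.
      intros t' H s. now apply is_path_derive_pair.
    + intros t Ht. now apply (proj2 (proj1 (Ccontinuous_pair _ _) (H2 t Ht))).
    + intros s. eexists. exact (proj2 (I s)).
Qed.

(** * Cauchy's formula on a star-shaped open set *)

(** The homothety of centre [z] and ratio [sin s ^ 2].  The ratio stays in [[0, 1]]
    for every real [s], so a set star-shaped around [z] is preserved for all [s]
    and derivatives in [s] at the ends [0] and [PI / 2] are two-sided. *)
Definition shrink (z : C) (s : R) (w : C) : C := (z + RtoC (sin s ^ 2) * (w - z))%C.

Lemma shrink_0 (z w : C) : shrink z 0 w = z.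
Proof. unfold shrink. rewrite sin_0. replace (0 ^ 2) with 0 by ring. ring. Qed.

Lemma shrink_PI2 (z w : C) : shrink z (PI / 2) w = w.
Proof. unfold shrink. rewrite sin_PI2. replace (1 ^ 2) with 1 by ring. ring. Qed.

Record path_in (U : C -> Prop) (z : C) (g dg : R -> C) (a b : R) : Prop := {
  path_derive : forall t, is_path_derive g t (dg t);
  path_C1 : forall t, Ccontinuous dg t;
  path_dom : forall t, Rmin a b <= t <= Rmax a b -> U (g t);
  path_avoid : forall t, Rmin a b <= t <= Rmax a b -> g t <> z
}.

Lemma path_kernel_continuous (U : C -> Prop) (z : C) (g dg : R -> C) (a b t : R) :
  path_in U z g dg a b -> Rmin a b <= t <= Rmax a b ->
  Ccontinuous (fun t => dg t / (g t - z))%C t.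
Proof.
  intros [Gd Gc GU Gz] Ht. apply Ccontinuous_mult; [apply Gc|].
  apply Ccontinuous_inv.
  - apply Ccontinuous_minus; [now apply path_continuous with dg | apply continuous_const].
  - now apply Cminus_eq_contra, Gz.
Qed.

Lemma path_kernel_ex_CInt (U : C -> Prop) (z : C) (g dg : R -> C) (a b : R) :
  path_in U z g dg a b -> ex_CInt (fun t => dg t / (g t - z))%C a b.
Proof.
  intros P. apply ex_CInt_continuous. intros t Ht. now apply (path_kernel_continuous U z g dg a b).
Qed.

Lemma path_integrand_ex_CInt (U : C -> Prop) (z : C) (h : C -> C) (g dg : R -> C) (a b : R) :
  (forall w, U w -> Ccontinuous_map h w) ->
  path_in U z g dg a b -> ex_CInt (fun t => h (g t) * (dg t / (g t - z)))%C a b.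
Proof.
  intros Hh P. apply ex_CInt_continuous. intros t Ht.
  apply Ccontinuous_mult; [|now apply (path_kernel_continuous U z g dg a b)].
  destruct P as [Gd Gc GU Gz].
  apply (continuous_comp (V := C_UniformSpace) g h).
  - now apply path_continuous with dg.
  - now apply Hh, GU.
Qed.

Section StarShaped.

Variables (U : C -> Prop) (z : C) (h dh : C -> C).
Hypothesis U_open : forall w, U w -> locally (T := C_UniformSpace) w U.
Hypothesis U_star : forall w s, U w -> U (shrink z s w).
Hypothesis h_derive : forall w, U w -> is_Cderive h w (dh w).
Hypothesis dh_continuous : forall w, U w -> Ccontinuous_map dh w.

Variables (g dg : R -> C) (a b : R).
Hypothesis Hg : path_in U z g dg a b.

(** Differentiating [h (shrink z s (g t))] in [s] produces a factor [g t - z] that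
    cancels the kernel, so that the derivative of the integral is a multiple of
    the integral [J] of [dh (shrink z s (g t)) * dg t].  Up to the factor
    [sin s ^ 2], the integrand of [J] is the derivative in [t] of
    [h (shrink z s (g t))], whence the second equality, in which only the end
    points of the path occur. *)
Lemma is_path_derive_shrunk_integral (s : R) :
  let J := CInt (fun t => dh (shrink z s (g t)) * dg t)%C a b in
  is_path_derive (fun u => CInt (fun t => h (shrink z u (g t)) * (dg t / (g t - z)))%C a b) s
    (RtoC (2 * sin s * cos s) * J)%C /\
  (RtoC (sin s ^ 2) * J = h (shrink z s (g b)) - h (shrink z s (g a)))%C.
Proof.
  destruct Hg as [Gd Gc GU Gz].
  assert (Cg : forall t, Ccontinuous g t) by (intros t; now apply path_continuous with dg).
  assert (Cs2 : forall s t, Ccontinuous (fun p : R * R => shrink z (fst p) (g (snd p))) (s, t)).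
  { intros s' t. apply Ccontinuous_plus; [apply continuous_const|].
    apply Ccontinuous_mult.
    - apply Ccontinuous_RtoC.
      apply (continuous_comp (U := R2) (V := R_UniformSpace) fst (fun r => sin r ^ 2)).
      + apply continuous_fst.
      + apply (ex_derive_continuous (V := R_NormedModule)). auto_derive; auto.
    - apply Ccontinuous_minus; [|apply continuous_const].
      apply (continuous_comp (U := R2) (V := R_UniformSpace) snd g).
      + apply continuous_snd.
      + apply Cg. }
  assert (Ct : forall s t, Ccontinuous (fun t => shrink z s (g t)) t).
  { intros s' t. apply (continuous_comp_2 (V := R_UniformSpace) (W := R_UniformSpace)
      (X := C_UniformSpace) (fun _ => s') (fun t => t) (fun s t => shrink z s (g t))).
    - apply continuous_const.
    - apply continuous_id.
    - apply Cs2. }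
  assert (Ck := fun t => path_kernel_continuous U z g dg a b t Hg).
  assert (CJ : forall t, Rmin a b <= t <= Rmax a b ->
     Ccontinuous (fun t => dh (shrink z s (g t)) * dg t)%C t).
  { intros t Ht. apply Ccontinuous_mult; [|apply Gc].
    apply (continuous_comp (V := C_UniformSpace) (fun t => shrink z s (g t)) dh); [apply Ct|].
    now apply dh_continuous, U_star, GU. }
  assert (dshrink : forall t, is_path_derive (fun t => shrink z s (g t)) t (RtoC (sin s ^ 2) * dg t)%C).
  { intros t. eapply (is_derive_ext (V := C_R_NormedModule)).
    2: apply (is_path_derive_affine (RtoC (sin s ^ 2)) (z - RtoC (sin s ^ 2) * z)%C g), Gd.
    intros t'. unfold shrink. Ceq. ring. }
  intros J. split.
  - unfold J. rewrite <- CInt_mult by now apply ex_CInt_continuous.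
    apply (is_path_derive_CInt_param (fun u t => h (shrink z u (g t)) * (dg t / (g t - z)))%C
      (fun s t => RtoC (2 * sin s * cos s) * (dh (shrink z s (g t)) * dg t))%C).
    + intros t Ht.
      assert (L1 : locally t (fun t' => U (g t'))).
      { apply (Cg t). now apply U_open, GU. }
      assert (L2 : locally t (fun t' => g t' <> z)).
      { apply (Cg t (fun w => w <> z)).
        now apply locally_Cneq, Gz. }
      generalize (filter_and _ _ L1 L2). apply filter_imp. intros t' [U' Z'] s'.
      replace (RtoC (2 * sin s' * cos s') * (dh (shrink z s' (g t')) * dg t'))%C
       with ((dg t' / (g t' - z)) * (dh (shrink z s' (g t')) * ((g t' - z) * RtoC (2 * sin s' * cos s'))))%C.
      2: { field. now apply Cminus_eq_contra. }
      eapply (is_derive_ext (V := C_R_NormedModule)).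
      2: apply (is_path_derive_affine _ (RtoC 0) (fun u => h (shrink z u (g t')))).
      { intros u. Ceq. ring. }
      apply is_path_derive_comp.
      { now apply h_derive, U_star. }
      eapply (is_derive_ext (V := C_R_NormedModule)).
      2: apply (is_path_derive_affine _ z (fun u => RtoC (sin u ^ 2))).
      { intros u. unfold shrink. Ceq. ring. }
      apply is_path_derive_RtoC. auto_derive; auto. ring.
    + intros t Ht. apply Ccontinuous_mult.
      * apply Ccontinuous_RtoC.
        apply (continuous_comp (U := R2) (V := R_UniformSpace) fst
          (fun r => 2 * sin r * cos r)).
        { apply continuous_fst. }
        apply (ex_derive_continuous (V := R_NormedModule)). auto_derive; auto.
      * apply Ccontinuous_mult.
        -- apply (continuous_comp (U := R2) (V := C_UniformSpace)
             (fun p : R * R => shrink z (fst p) (g (snd p))) dh); [apply Cs2|].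
           now apply dh_continuous, U_star, GU.
        -- apply (continuous_comp (U := R2) (V := R_UniformSpace) snd dg).
           { apply continuous_snd. }
           apply Gc.
    + intros s'. apply ex_CInt_continuous. intros t Ht.
      apply Ccontinuous_mult; [|now apply Ck].
      apply (continuous_comp (V := C_UniformSpace) (fun t => shrink z s' (g t)) h); [apply Ct|].
      apply is_Cderive_continuous with (dh (shrink z s' (g t))).
      now apply h_derive, U_star, GU.
  - unfold J. rewrite <- CInt_mult by now apply ex_CInt_continuous.
    apply is_CInt_unique.
    apply (is_RInt_derive (V := C_R_CompleteNormedModule) (fun t => h (shrink z s (g t)))).
    + intros t Ht.
      replace (RtoC (sin s ^ 2) * (dh (shrink z s (g t)) * dg t))%C
        with (dh (shrink z s (g t)) * (RtoC (sin s ^ 2) * dg t))%C by ring.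
      apply is_path_derive_comp; [now apply h_derive, U_star, GU | apply dshrink].
    + intros t Ht. apply Ccontinuous_mult; [apply continuous_const | now apply CJ].
Qed.

End StarShaped.

(** By [is_path_derive_shrunk_integral] the integrals over the two shrunk paths
    have the same derivative in [s]: where [sin s = 0] both derivatives vanish,
    elsewhere the end points determine them.  At [s = PI / 2] the paths are the
    given ones, and at [s = 0] they are reduced to [z]. *)
Theorem cauchy_path_independence (U : C -> Prop) (z : C) (h dh : C -> C)
  (g1 dg1 g2 dg2 : R -> C) (a1 b1 a2 b2 : R) :
  (forall w, U w -> locally (T := C_UniformSpace) w U) ->
  (forall w s, U w -> U (shrink z s w)) ->
  (forall w, U w -> is_Cderive h w (dh w)) ->
  (forall w, U w -> Ccontinuous_map dh w) ->
  path_in U z g1 dg1 a1 b1 -> path_in U z g2 dg2 a2 b2 ->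
  g1 a1 = g2 a2 -> g1 b1 = g2 b2 ->
  (CInt (fun t => h (g1 t) * (dg1 t / (g1 t - z))) a1 b1
     - h z * CInt (fun t => dg1 t / (g1 t - z)) a1 b1 =
   CInt (fun t => h (g2 t) * (dg2 t / (g2 t - z))) a2 b2
     - h z * CInt (fun t => dg2 t / (g2 t - z)) a2 b2)%C.
Proof.
  intros Uo Us Hh Hdh P1 P2 Ea Eb.
  set (Phi g dg a b s := CInt (fun t => h (shrink z s (g t)) * (dg t / (g t - z)))%C a b).
  assert (E1 : forall g dg a b, Phi g dg a b (PI / 2) = CInt (fun t => h (g t) * (dg t / (g t - z)))%C a b).
  { intros g dg a b. apply CInt_ext. intros t _. now rewrite shrink_PI2. }
  assert (E0 : forall g dg a b, path_in U z g dg a b ->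
     Phi g dg a b 0 = (h z * CInt (fun t => dg t / (g t - z)) a b)%C).
  { intros g dg a b P. rewrite <- CInt_mult by now apply (path_kernel_ex_CInt U).
    apply CInt_ext. intros t _. now rewrite shrink_0. }
  rewrite <- !E1, <- !E0 by assumption.
  assert (D : (Phi g1 dg1 a1 b1 0 - Phi g2 dg2 a2 b2 0 =
    Phi g1 dg1 a1 b1 (PI / 2)%R - Phi g2 dg2 a2 b2 (PI / 2)%R)%C).
  { apply (eq_is_derive (V := C_R_NormedModule)
      (fun s => Phi g1 dg1 a1 b1 s - Phi g2 dg2 a2 b2 s)%C 0 (PI / 2)).
    2: generalize PI_RGT_0; lra.
    intros s _.
    destruct (is_path_derive_shrunk_integral U z h dh Uo Us Hh Hdh g1 dg1 a1 b1 P1 s) as [D1 J1].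
    destruct (is_path_derive_shrunk_integral U z h dh Uo Us Hh Hdh g2 dg2 a2 b2 P2 s) as [D2 J2].
    rewrite Ea, Eb, <- J2 in J1. clear J2.
    assert (DD := is_derive_minus (K := R_AbsRing) (V := C_R_NormedModule) _ _ _ _ _ D1 D2).
    clear D1 D2.
    match type of DD with is_derive _ _ ?l => replace (@zero C_R_NormedModule) with l; [exact DD|] end.
    clear DD.
    set (K1 := CInt _ a1 b1) in *. set (K2 := CInt _ a2 b2) in *.
    change ((RtoC (2 * sin s * cos s) * K1 - RtoC (2 * sin s * cos s) * K2)%C = RtoC 0).
    destruct (Req_dec (sin s) 0) as [S | S].
    - rewrite S. replace (2 * 0 * cos s) with 0 by ring. ring.
    - assert (K1 = K2) as ->; [|ring].
      assert (S2 : RtoC (sin s ^ 2) <> 0).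
      { intros E. apply RtoC_inj in E. now apply (pow_nonzero (sin s) 2) in S. }
      now apply Cmult_cancel_l with (RtoC (sin s ^ 2)). }
  apply Ceq_minus in D. apply Ceq_minus. rewrite <- Copp_0, <- D. ring.
Qed.

(** * The kernel integrals along the imaginary axis and a half-circle *)

Definition imag_axis (y : R) : C := (0, y).

Definition half_circle (r t : R) : C := (r * cos t, r * sin t).

Lemma imag_axis_derive (y : R) : is_path_derive imag_axis y Ci.
Proof.
  apply is_path_derive_pair. split; simpl.
  - apply (is_derive_const (K := R_AbsRing) (V := R_NormedModule) 0).
  - apply (is_derive_id (K := R_AbsRing)).
Qed.

Lemma half_circle_derive (r t : R) :
  is_path_derive (half_circle r) t (Ci * half_circle r t)%C.
Proof.
  apply is_path_derive_pair. split; simpl; auto_derive; auto; ring.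
Qed.

Lemma Cmod_half_circle (r t : R) : 0 <= r -> Cmod (half_circle r t) = r.
Proof.
  intros Hr. unfold Cmod, half_circle. simpl fst. simpl snd.
  replace ((r * cos t) ^ 2 + (r * sin t) ^ 2) with (Rsqr r * ((sin t)² + (cos t)²))
    by (unfold Rsqr; ring).
  rewrite sin2_cos2, Rmult_1_r. now apply sqrt_Rsqr.
Qed.

Lemma sum_sqr_pos (a c : R) : 0 < a -> 0 < a ^ 2 + c ^ 2.
Proof. intros Ha. generalize (pow_lt a 2 Ha) (pow2_ge_0 c). lra. Qed.

Lemma imag_kernel (z : C) (y : R) : 0 < Re z ->
  (Ci / (imag_axis y - z))%C =
  ((y - Im z) / (Re z ^ 2 + (y - Im z) ^ 2), - Re z / (Re z ^ 2 + (y - Im z) ^ 2)).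
Proof.
  destruct z as [a b]. unfold Re, Im. simpl fst. simpl snd. intros Ha.
  assert (HD : a ^ 2 + (y - b) ^ 2 <> 0).
  { apply Rgt_not_eq. now apply sum_sqr_pos. }
  assert (HW : (imag_axis y - (a, b))%C <> 0).
  { intros E. apply (f_equal fst) in E. simpl in E. lra. }
  apply Cmult_cancel_l with (imag_axis y - (a, b))%C; [exact HW|].
  transitivity Ci; [now field|].
  apply injective_projections; simpl; field; contradict HD; rewrite <- HD; ring.
Qed.

Lemma ln_diff_le (A B : R) : 0 < A -> 0 < B -> ln A - ln B <= (A - B) / B.
Proof.
  intros HA HB. rewrite <- ln_div by assumption.
  assert (H : 0 < A / B) by now apply Rdiv_lt_0_compat.
  generalize (exp_ineq1_le (ln (A / B))). rewrite exp_ln by assumption.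
  replace ((A - B) / B) with (A / B - 1) by (field; lra). lra.
Qed.

Lemma atan_le_id (x : R) : 0 <= x -> 0 <= atan x <= x.
Proof.
  intros Hx. split.
  - rewrite <- atan_0. destruct Hx as [Hx | <-]; [left; now apply atan_increasing | right; reflexivity].
  - destruct Hx as [Hx | <-]; [|rewrite atan_0; lra].
    destruct (MVT_gen atan 0 x (fun u => / (1 + u²))) as [c [Hc E]].
    + intros u _. apply is_derive_atan.
    + intros u _. apply continuity_pt_filterlim.
      apply (ex_derive_continuous (V := R_NormedModule)). eexists. apply is_derive_atan.
    + rewrite atan_0 in E.
      assert (/ (1 + c²) <= 1).
      { rewrite <- Rinv_1 at 2. apply Rinv_le_contravar; generalize (Rle_0_sqr c); lra. }
      nra.
Qed.

(** The kernel has an elementary primitive: its real part is a logarithm, whose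
    increment over [[-r, r]] is small because the end points are almost equally
    distant from [z]; its imaginary part is the opposite of an arctangent, whose
    increment tends to [PI]. *)
Lemma imag_winding (z : C) (r : R) : 0 < Re z -> 0 < r -> 2 * Cmod z <= r ->
  Cmod (CInt (fun y => Ci / (imag_axis y - z))%C (- r) r + Ci * RtoC PI) <= 12 * Cmod z / r.
Proof.
  intros Ha Hr Hz.
  assert (Ra := re_le_Cmod z). assert (Rb := im_le_Cmod z).
  set (a := Re z) in *. set (b := Im z) in *. set (m := Cmod z) in *.
  assert (D : forall y, 0 < a ^ 2 + (y - b) ^ 2) by (intros y; now apply sum_sqr_pos).
  rewrite (is_CInt_unique _ _ _
    (/ 2 * ln (a ^ 2 + (r - b) ^ 2) - / 2 * ln (a ^ 2 + (- r - b) ^ 2),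
      - atan ((r - b) / a) - - atan ((- r - b) / a))).
  2: { apply (is_RInt_ext (V := C_R_NormedModule)
        (fun y => ((y - b) / (a ^ 2 + (y - b) ^ 2), - a / (a ^ 2 + (y - b) ^ 2)))).
       { intros y _. now rewrite imag_kernel. }
       apply is_CInt_pair. split; simpl fst; simpl snd.
       - apply (is_RInt_derive (V := R_CompleteNormedModule) (fun y => / 2 * ln (a ^ 2 + (y - b) ^ 2))).
         + intros y _. specialize (D y). auto_derive; [easy|]. field. nra.
         + intros y _. specialize (D y). apply (ex_derive_continuous (V := R_NormedModule)).
           auto_derive. nra.
       - apply (is_RInt_derive (V := R_CompleteNormedModule) (fun y => - atan ((y - b) / a))).
         + intros y _. specialize (D y). auto_derive; [easy|]. unfold Rsqr. field. split; nra.
         + intros y _. specialize (D y). apply (ex_derive_continuous (V := R_NormedModule)).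
           auto_derive. nra. }
  assert (Hb : - m <= b <= m) by (apply Rabs_le_between; exact Rb).
  assert (Ham : a <= m) by (eapply Rle_trans; [apply Rle_abs | exact Ra]).
  assert (A1 : PI / 2 - atan ((r - b) / a) = atan (a / (r - b))).
  { rewrite <- atan_inv.
    - f_equal. field. split; lra.
    - apply Rdiv_lt_0_compat; lra. }
  assert (A2 : PI / 2 + atan ((- r - b) / a) = atan (a / (r + b))).
  { replace ((- r - b) / a) with (- ((r + b) / a)) by (field; lra).
    rewrite atan_opp. transitivity (PI / 2 - atan ((r + b) / a)); [ring|].
    rewrite <- atan_inv.
    - f_equal. field. split; lra.
    - apply Rdiv_lt_0_compat; lra. }
  assert (Q : forall c, r / 2 <= c -> 0 <= atan (a / c) <= 2 * m / r).
  { intros c Hc. destruct (atan_le_id (a / c)) as [B1 B2].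
    - left. apply Rdiv_lt_0_compat; lra.
    - split; [exact B1|]. eapply Rle_trans; [exact B2|].
      apply Rle_div_l; [lra|]. replace (2 * m / r * c) with (m * (2 * c / r)) by (field; lra).
      assert (1 <= 2 * c / r) by (apply Rle_div_r; lra). nra. }
  assert (Q1 := Q (r - b) ltac:(lra)). assert (Q2 := Q (r + b) ltac:(lra)).
  (* To be used with [c] and [d] equal to [r - b] and [- r - b] in either order:
     then [d ^ 2 - c ^ 2] is [4 r b] up to sign. *)
  assert (LQ : forall c d, r / 2 <= Rabs c -> 0 < a ^ 2 + d ^ 2 -> d ^ 2 - c ^ 2 <= 4 * m * r ->
     ln (a ^ 2 + d ^ 2) - ln (a ^ 2 + c ^ 2) <= 16 * m / r).
  { intros c d Hc Hd Hcd.
    assert (Hc2 : (r / 2) ^ 2 <= c ^ 2).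
    { rewrite <- (pow2_abs c). apply pow_incr. lra. }
    assert (HB : 0 < a ^ 2 + c ^ 2) by nra.
    eapply Rle_trans; [now apply ln_diff_le|].
    apply Rle_div_l; [exact HB|].
    replace (16 * m / r * (a ^ 2 + c ^ 2)) with (16 * m / r * ((a ^ 2 + c ^ 2 - (r / 2) ^ 2)) + 4 * m * r)
      by (field; lra).
    assert (0 <= 16 * m / r) by (apply Rdiv_le_0_compat; lra).
    assert (0 <= a ^ 2 + c ^ 2 - (r / 2) ^ 2) by nra.
    nra. }
  assert (L1 := LQ (- r - b) (r - b)). assert (L2 := LQ (r - b) (- r - b)).
  assert (Rabs (r - b) = r - b) as Er by (apply Rabs_right; lra).
  assert (Rabs (- r - b) = r + b) as Er' by (rewrite Rabs_left; lra).
  rewrite Er' in L1. rewrite Er in L2.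
  specialize (L1 ltac:(lra) (D r) ltac:(nra)). specialize (L2 ltac:(lra) (D (- r)) ltac:(nra)).
  assert (X : 12 * m / r = 16 * m / r / 2 + (2 * m / r + 2 * m / r)) by (field; lra).
  rewrite X. eapply Rle_trans; [apply Cmod_le_abs|].
  set (l1 := ln (a ^ 2 + (r - b) ^ 2)) in *. set (l2 := ln (a ^ 2 + (- r - b) ^ 2)) in *.
  simpl. apply Rplus_le_compat.
  - apply Rabs_le_between. split; lra.
  - apply Rabs_le_between. split; lra.
Qed.

Lemma right_of_open (d : R) (w : C) :
  - d < Re w -> locally (T := C_UniformSpace) w (fun w => - d < Re w).
Proof.
  intros Hw. destruct w as [x y].
  apply (continuous_fst (U := R_UniformSpace) (V := R_UniformSpace) x y (fun x => - d < x)).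
  now apply open_gt.
Qed.

Lemma right_of_shrink (d : R) (z w : C) (s : R) :
  0 < d -> 0 < Re z -> - d < Re w -> - d < Re (shrink z s w).
Proof.
  unfold shrink. destruct z as [a b], w as [x y]. simpl. intros Hd Ha Hx.
  set (q := sin s * (sin s * 1)).
  assert (Hq : 0 <= q <= 1).
  { unfold q. generalize (sin2_cos2 s) (Rle_0_sqr (sin s)) (Rle_0_sqr (cos s)). unfold Rsqr. lra. }
  replace (a + (q * (x + - a) - 0 * (y + - b))) with ((1 - q) * a + q * x) by ring.
  assert (0 <= (1 - q) * a) by (apply Rmult_le_pos; lra).
  destruct (Rle_dec 0 x).
  - assert (0 <= q * x) by (apply Rmult_le_pos; lra). lra.
  - assert (q * x >= x) by nra. lra.
Qed.

Section HalfPlane.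

Variables (d : R) (z : C).
Hypothesis Hd : 0 < d.
Hypothesis Hz : 0 < Re z.

Lemma path_in_imag_axis (r : R) :
  path_in (fun w => - d < Re w) z imag_axis (fun _ => Ci) (- r) r.
Proof.
  split.
  - apply imag_axis_derive.
  - intros t. apply continuous_const.
  - intros t _. simpl. lra.
  - intros t _ E. rewrite <- E in Hz. simpl in Hz. lra.
Qed.

Lemma path_in_half_circle (r : R) : 0 < r -> 2 * Cmod z <= r ->
  path_in (fun w => - d < Re w) z (half_circle r) (fun t => Ci * half_circle r t)%C (- (PI / 2)) (PI / 2).
Proof.
  intros Hr Hzr. split.
  - apply half_circle_derive.
  - intros t. apply Ccontinuous_mult; [apply continuous_const|].
    apply path_continuous with (fun t => Ci * half_circle r t)%C, half_circle_derive.
  - intros t Ht. generalize PI_RGT_0. intros P. rewrite Rmin_left, Rmax_right in Ht by lra. simpl.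
    assert (0 <= cos t) by (apply cos_ge_0; lra). 
    assert (0 <= r * cos t) by (apply Rmult_le_pos; lra). lra.
  - intros t _ E. assert (E' := Cmod_half_circle r t ltac:(lra)). rewrite E in E'. lra.
Qed.

Lemma half_circle_kernel_bound (r t : R) : 0 < r -> 2 * Cmod z <= r ->
  Cmod (Ci * half_circle r t / (half_circle r t - z)) <= 2.
Proof.
  intros Hr Hzr. assert (E := Cmod_half_circle r t ltac:(lra)).
  assert (H := Cmod_minus_ge (half_circle r t) z). rewrite E in H.
  rewrite Cmod_div by (intros E0; rewrite E0, Cmod_0 in H; lra).
  rewrite Cmod_mult, Cmod_Ci, E. apply Rle_div_l; lra.
Qed.

(** For [z = 0] the kernel is the constant [i]; the difference is
    [i z / (half_circle r t - z)]. *)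
Lemma half_circle_winding (r : R) : 0 < r -> 2 * Cmod z <= r ->
  Cmod (CInt (fun t => Ci * half_circle r t / (half_circle r t - z))%C (- (PI / 2)) (PI / 2)
    - Ci * RtoC PI) <= 8 * Cmod z / r.
Proof.
  intros Hr Hzr. set (k t := (Ci * half_circle r t / (half_circle r t - z))%C).
  assert (Nz : forall t, (half_circle r t - z)%C <> 0).
  { intros t E. assert (E' := Cmod_half_circle r t ltac:(lra)).
    assert (H := Cmod_minus_ge (half_circle r t) z). rewrite E, Cmod_0 in H. lra. }
  assert (Ek : ex_CInt k (- (PI / 2)) (PI / 2)).
  { apply (path_kernel_ex_CInt (fun w => - d < Re w)). now apply path_in_half_circle. }
  assert (I : is_CInt (fun t => k t - Ci)%C (- (PI / 2)) (PI / 2)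
     (CInt k (- (PI / 2)) (PI / 2) - Ci * RtoC PI)%C).
  { apply (is_RInt_minus (V := C_R_NormedModule)).
    - now apply CInt_correct.
    - replace (Ci * RtoC PI)%C with (@scal _ C_R_NormedModule (PI / 2 - - (PI / 2)) Ci).
      + apply (is_RInt_const (V := C_R_NormedModule)).
      + rewrite scal_R_Cmult. replace (PI / 2 - - (PI / 2)) with PI by field. apply Cmult_comm. }
  rewrite <- (is_CInt_unique _ _ _ _ I).
  generalize PI_RGT_0 PI_4. intros P P4.
  assert (Cz := Cmod_ge_0 z).
  eapply Rle_trans; [apply Cmod_CInt_le with (M := 2 * Cmod z / r)|].
  - lra.
  - eexists. exact I.
  - intros t _. unfold k.
    replace (Ci * half_circle r t / (half_circle r t - z) - Ci)%C
      with (Ci * z / (half_circle r t - z))%C by (field; apply Nz).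
    rewrite Cmod_div by apply Nz. rewrite Cmod_mult, Cmod_Ci, Rmult_1_l.
    assert (H := Cmod_minus_ge (half_circle r t) z).
    rewrite Cmod_half_circle in H by lra.
    apply Rle_div_l; [lra|].
    replace (2 * Cmod z / r * Cmod (half_circle r t - z))
      with (Cmod z * (2 * Cmod (half_circle r t - z) / r)) by (field; lra).
    assert (1 <= 2 * Cmod (half_circle r t - z) / r) by (apply Rle_div_r; lra).
    nra.
  - replace (8 * Cmod z / r) with (4 * (2 * Cmod z / r)) by (field; lra).
    apply Rmult_le_compat_r; [apply Rdiv_le_0_compat; lra | lra].
Qed.

(** * Cauchy's formula on the right half-plane *)

Variables h dh : C -> C.
Hypothesis h_derive : forall w, - d < Re w -> is_Cderive h w (dh w).
Hypothesis dh_continuous : forall w, - d < Re w -> Ccontinuous_map dh w.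
Hypothesis h_vanishes : forall eps, 0 < eps -> exists M, forall w,
  0 <= Re w -> M <= Cmod w -> Cmod (h w) <= eps.

(** The axis segment and the half-circle of radius [r] have the same end points,
    so [cauchy_path_independence] compares the two integrals.  The one over the
    half-circle tends to [0] with [h], and the two kernel integrals, which [h z]
    multiplies, differ by [- 2 i PI] in the limit. *)
Theorem half_plane_cauchy_formula :
  filterlim (fun r => CInt (fun y => h (imag_axis y) * (Ci / (imag_axis y - z)))%C (- r) r)
    (Rbar_locally p_infty)
    (locally (T := C_UniformSpace) (- (Ci * RtoC (2 * PI) * h z))%C).
Proof.
  apply Cfilterlim_eps; [apply _|]. intros eps Heps.
  (* The half-circle contributes at most [PI * 2 * (eps / 32) <= eps / 4], and [K / r]
     bounds the errors on the two kernel integrals, multiplied by [|h z|]. *)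
  destruct (h_vanishes (eps / 32)) as [M HM]; [lra|].
  assert (Cz := Cmod_ge_0 z). assert (Ch := Cmod_ge_0 (h z)).
  set (K := 20 * Cmod (h z) * Cmod z).
  assert (HK : 0 <= K) by (apply Rmult_le_pos; [lra | exact Cz]).
  exists (Rmax 1 (Rmax M (Rmax (2 * Cmod z) (2 * K / eps)))). intros r Hr.
  apply Rmax_Rlt in Hr as [Hr1 Hr]. apply Rmax_Rlt in Hr as [Hr2 Hr].
  apply Rmax_Rlt in Hr as [Hr3 Hr4].
  assert (HW1 := imag_winding z r Hz ltac:(lra) ltac:(lra)).
  assert (HW2 := half_circle_winding r ltac:(lra) ltac:(lra)).
  assert (P2 := path_in_half_circle r ltac:(lra) ltac:(lra)).
  assert (HI := cauchy_path_independence _ z h dh _ _ _ _ _ _ _ _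
    (right_of_open d) (fun w s => right_of_shrink d z w s Hd Hz)
    h_derive dh_continuous (path_in_imag_axis r) P2).
  assert (E1 : imag_axis (- r) = half_circle r (- (PI / 2))).
  { unfold imag_axis, half_circle. rewrite cos_neg, sin_neg, cos_PI2, sin_PI2.
    f_equal; ring. }
  assert (E2 : imag_axis r = half_circle r (PI / 2)).
  { unfold imag_axis, half_circle. rewrite cos_PI2, sin_PI2. f_equal; ring. }
  specialize (HI E1 E2). clear E1 E2. cbv beta in HI.
  set (I := CInt (fun y => h (imag_axis y) * (Ci / (imag_axis y - z)))%C (- r) r) in *.
  set (L := CInt (fun y => Ci / (imag_axis y - z))%C (- r) r) in *.
  match type of HI with (_ = ?e - _ * ?a)%C => set (e' := e) in *; set (A := a) in * end.
  replace (I - - (Ci * RtoC (2 * PI) * h z))%C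
    with (e' + (h z * (L + Ci * RtoC PI) + - (h z * (A - Ci * RtoC PI))))%C.
  2: { replace I with (e' - h z * A + h z * L)%C by (rewrite <- HI; ring).
       rewrite RtoC_mult. ring. }
  assert (He : Cmod e' <= 4 * (eps / 32 * 2)).
  { assert (P := PI_RGT_0). assert (P4 := PI_4). unfold e'.
    eapply Rle_trans; [apply Cmod_CInt_le with (M := eps / 32 * 2)|].
    - lra.
    - apply (path_integrand_ex_CInt (fun w => - d < Re w)); [|exact P2].
      intros w Hw. apply is_Cderive_continuous with (dh w). now apply h_derive.
    - intros t Ht. rewrite Cmod_mult. apply Rmult_le_compat; try apply Cmod_ge_0.
      + apply HM.
        * simpl. apply Rmult_le_pos; [lra|]. apply cos_ge_0; lra.
        * rewrite Cmod_half_circle; lra.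
      + apply half_circle_kernel_bound; lra.
    - apply Rmult_le_compat_r; lra. }
  eapply Rle_lt_trans; [apply Cmod_triangle|].
  eapply Rle_lt_trans; [apply Rplus_le_compat_l, Cmod_triangle|].
  rewrite Cmod_opp, !Cmod_mult.
  assert (T1 : Cmod (h z) * Cmod (L + Ci * RtoC PI) <= Cmod (h z) * (12 * Cmod z / r))
    by now apply Rmult_le_compat_l.
  assert (T2 : Cmod (h z) * Cmod (A - Ci * RtoC PI) <= Cmod (h z) * (8 * Cmod z / r))
    by now apply Rmult_le_compat_l.
  assert (T3 : Cmod (h z) * (12 * Cmod z / r) + Cmod (h z) * (8 * Cmod z / r) = K / r)
    by (unfold K; field; lra).
  assert (T4 : K / r <= eps / 2).
  { apply Rle_div_l; [lra|]. apply Rlt_le in Hr4. apply Rle_div_l in Hr4; lra. }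
  lra.
Qed.

End HalfPlane.

(** * The principal branch on the closed right half-plane *)

Lemma slit_plane_right (z : C) : - / exp 1 < Re z -> slit_plane z.
Proof. intros H [_ H']. lra. Qed.

Lemma slit_plane_closed_right (z : C) : 0 <= Re z -> slit_plane z.
Proof.
  intros H. apply slit_plane_right.
  generalize (Rinv_0_lt_compat _ (exp_pos 1)). lra.
Qed.

Lemma mult_sin_nonneg (v : R) : - (PI / 2) < v < PI / 2 -> 0 <= v * sin v.
Proof.
  intros Hv. assert (P := PI_RGT_0). destruct (Rle_dec 0 v).
  - apply Rmult_le_pos; [assumption | apply sin_ge_0; lra].
  - replace (v * sin v) with (- v * sin (- v)) by (rewrite sin_neg; ring).
    apply Rmult_le_pos; [lra | apply sin_ge_0; lra].
Qed.

Lemma cos_pos_strip (v : R) : - (PI / 2) < v < PI / 2 -> 0 < cos v.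
Proof. intros Hv. apply cos_gt_0; lra. Qed.

Section LambertW.

Variable W : C -> C.
Hypothesis HW : is_principal_LambertW W.

Lemma LambertW_eq (z : C) : slit_plane z -> (W z * Cexp (W z))%C = z.
Proof. apply HW. Qed.

Lemma LambertW_continuous (z : C) :
  slit_plane z -> Ccontinuous_map W z.
Proof.
  intros Hz. destruct (proj1 HW z Hz) as [l Hl]. now apply is_Cderive_continuous with l.
Qed.

(** Differentiate [W w * Cexp (W w) = w].  The product equal to [1] shows both that
    [1 + W z] does not vanish and what the derivative is, hence that the
    derivative is continuous. *)
Lemma LambertW_derive_aux (z : C) (l : C) : - / exp 1 < Re z -> is_Cderive W z l ->
  (l * ((1 + W z) * Cexp (W z)) = 1)%C.
Proof.
  intros Hz Hl.
  assert (D1 : is_Cderive (fun w => W w * Cexp (W w))%C z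
    (l * Cexp (W z) + W z * (l * Cexp (W z)))%C).
  { apply (is_Cderive_mult W (fun w => Cexp (W w))); [exact Hl|].
    apply (is_Cderive_comp Cexp W); [apply is_Cderive_Cexp | exact Hl]. }
  assert (D2 : is_Cderive (fun w => W w * Cexp (W w))%C z (RtoC 1)).
  { apply (is_derive_ext_loc (K := C_AbsRing) (V := C_NormedModule) (fun w => RtoC 1 * w + RtoC 0)%C).
    - apply locally_C. apply (right_of_open (/ exp 1)) in Hz. revert Hz. apply filter_imp.
      intros w Hw. Ceq. rewrite LambertW_eq by now apply slit_plane_right. ring.
    - apply is_Cderive_affine. }
  etransitivity; [|exact (is_Cderive_unique _ _ _ _ D1 D2)]. ring.
Qed.

Definition LambertW_derivative (z : C) : C := (/ ((1 + W z) * Cexp (W z)))%C.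

Lemma LambertW_derivative_denominator (z : C) :
  - / exp 1 < Re z -> ((1 + W z) * Cexp (W z))%C <> 0.
Proof.
  intros Hz E. destruct (proj1 HW z (slit_plane_right z Hz)) as [l Hl].
  apply LambertW_derive_aux in Hl; [|exact Hz]. rewrite E, Cmult_0_r in Hl.
  apply RtoC_inj in Hl. lra.
Qed.

Lemma is_Cderive_LambertW (z : C) : - / exp 1 < Re z -> is_Cderive W z (LambertW_derivative z).
Proof.
  intros Hz. destruct (proj1 HW z (slit_plane_right z Hz)) as [l Hl].
  assert (H0 := LambertW_derivative_denominator z Hz).
  replace (LambertW_derivative z) with l; [exact Hl|].
  apply (Cmult_cancel_l _ _ _ H0). unfold LambertW_derivative.
  rewrite Cinv_r by exact H0. rewrite Cmult_comm. now apply LambertW_derive_aux.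
Qed.

Lemma LambertW_derivative_continuous (z : C) : - / exp 1 < Re z ->
  Ccontinuous_map LambertW_derivative z.
Proof.
  intros Hz. assert (CW := LambertW_continuous z (slit_plane_right z Hz)).
  apply Ccontinuous_inv.
  - apply Ccontinuous_mult; [| now apply Ccontinuous_Cexp].
    apply Ccontinuous_plus; [apply continuous_const | exact CW].
  - now apply LambertW_derivative_denominator.
Qed.

Lemma LambertW_parts (z : C) : slit_plane z ->
  Re z = exp (Re (W z)) * (Re (W z) * cos (Im (W z)) - Im (W z) * sin (Im (W z))) /\
  Im z = exp (Re (W z)) * (Re (W z) * sin (Im (W z)) + Im (W z) * cos (Im (W z))).
Proof.
  intros Hz. assert (E := LambertW_eq z Hz). split.
  - etransitivity; [symmetry; exact (f_equal Re E)|]. unfold Cexp, Re, Im. simpl. ring.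
  - etransitivity; [symmetry; exact (f_equal Im E)|]. unfold Cexp, Re, Im. simpl. ring.
Qed.

(** Along the ray from [0] to [z] the imaginary part of [W] starts from [0] and
    would have to take one of the values [PI / 2] and [- (PI / 2)] in order to
    leave the strip; there [w * Cexp w] has real part
    [- exp (Re w) * (PI / 2) < 0], while the ray stays in the closed right
    half-plane. *)
Lemma LambertW_Im_bound (z : C) : 0 <= Re z -> - (PI / 2) < Im (W z) < PI / 2.
Proof.
  intros Hz. assert (P := PI_RGT_0).
  (* Squaring the parameter keeps the ray in the half-plane for every real [t],
     so that [f] is continuous on all of [R], as [IVT_gen] requires. *)
  set (f t := Im (W (RtoC (t ^ 2) * z)%C)).
  assert (Hpos : forall t, 0 <= Re (RtoC (t ^ 2) * z)%C).
  { intros t. destruct z as [x y]. simpl. simpl in Hz.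
    replace (t * (t * 1) * x - 0 * y) with (t ^ 2 * x) by ring.
    apply Rmult_le_pos; [apply pow2_ge_0 | exact Hz]. }
  assert (Hf : continuity f).
  { intros t. apply continuity_pt_filterlim.
    apply (proj1 (Ccontinuous_pair _ _)).
    apply (continuous_comp (V := C_UniformSpace) (fun t => RtoC (t ^ 2) * z)%C W).
    - apply Ccontinuous_mult; [|apply continuous_const].
      apply Ccontinuous_RtoC. apply (ex_derive_continuous (V := R_NormedModule)). auto_derive; auto.
    - apply LambertW_continuous, slit_plane_closed_right, Hpos. }
  assert (F0 : f 0 = 0).
  { unfold f. replace (RtoC (0 ^ 2) * z)%C with (RtoC 0)
      by (replace (0 ^ 2) with 0 by ring; ring).
    now rewrite (proj2 (proj2 HW)). }
  assert (F1 : f 1 = Im (W z)).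
  { unfold f. do 2 f_equal. replace (1 ^ 2) with 1 by ring. ring. }
  assert (Hne : forall t, f t <> PI / 2 /\ f t <> - (PI / 2)).
  { intros t. destruct (LambertW_parts _ (slit_plane_closed_right _ (Hpos t))) as [E _].
    specialize (Hpos t). rewrite E in Hpos. fold (f t) in Hpos.
    assert (E1 := exp_pos (Re (W (RtoC (t ^ 2) * z)%C))).
    split; intros Ef; rewrite Ef in Hpos.
    - rewrite cos_PI2, sin_PI2 in Hpos. nra.
    - rewrite cos_neg, sin_neg, cos_PI2, sin_PI2 in Hpos. nra. }
  split.
  - apply Rnot_le_lt. intros H.
    destruct (IVT_gen f 0 1 (- (PI / 2)) Hf) as [t [_ Ht]].
    + rewrite F0, F1, Rmin_right, Rmax_left; lra.
    + now apply (proj2 (Hne t)).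
  - apply Rnot_le_lt. intros H.
    destruct (IVT_gen f 0 1 (PI / 2) Hf) as [t [_ Ht]].
    + rewrite F0, F1, Rmin_left, Rmax_right; lra.
    + now apply (proj1 (Hne t)).
Qed.

Lemma LambertW_Re_nonneg (z : C) : 0 <= Re z -> 0 <= Re (W z).
Proof.
  intros Hz. assert (Hv := LambertW_Im_bound z Hz).
  destruct (LambertW_parts z (slit_plane_closed_right z Hz)) as [E _]. rewrite E in Hz.
  assert (E1 := exp_pos (Re (W z))). assert (Hs := mult_sin_nonneg _ Hv).
  assert (Hc : 0 < cos (Im (W z))) by (apply cos_gt_0; lra).
  set (u := Re (W z)) in *. set (v := Im (W z)) in *.
  apply Rnot_lt_le. intros Hu.
  assert (u * cos v < 0) by nra. nra.
Qed.

(** Taking moduli in [W z * Cexp (W z) = z] gives [|z| = |W z| exp (Re (W z))],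
    and [exp u >= 1 + u >= |W z| / 2] with [u = Re (W z)], as
    [|Im (W z)| < PI / 2 <= 2]. *)
Lemma LambertW_growth (z : C) : 0 <= Re z -> Cmod (W z) ^ 2 <= 2 * Cmod z.
Proof.
  intros Hz. assert (Hv := LambertW_Im_bound z Hz). assert (Hu := LambertW_Re_nonneg z Hz).
  rewrite <- (LambertW_eq z (slit_plane_closed_right z Hz)) at 2.
  rewrite Cmod_mult, Cmod_Cexp.
  assert (P4 := PI_4). assert (He := exp_ineq1_le (Re (W z))).
  assert (Hm : Cmod (W z) <= Re (W z) + 2).
  { eapply Rle_trans; [apply Cmod_le_abs|]. fold (Re (W z)) (Im (W z)).
    apply Rplus_le_compat.
    - rewrite Rabs_right; lra.
    - apply Rabs_le. lra. }
  assert (Cw := Cmod_ge_0 (W z)). nra.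
Qed.

(** * The parametrisation of the imaginary axis *)

(** The ordinate of the point of the imaginary axis at which the imaginary part of
    [W] is [v]. *)
Definition LambertW_ordinate (v : R) : R := v * sec v * exp (v * tan v).

Definition LambertW_ordinate_derive (v : R) : R :=
  (v ^ 2 + (1 + v * tan v) ^ 2) * sec v * exp (v * tan v).

Lemma is_derive_LambertW_ordinate (v : R) : - (PI / 2) < v < PI / 2 ->
  is_derive LambertW_ordinate v (LambertW_ordinate_derive v).
Proof.
  intros Hv. apply cos_pos_strip in Hv. unfold LambertW_ordinate, LambertW_ordinate_derive, sec, tan.
  auto_derive; [lra|].
  unfold Rdiv. field. lra.
Qed.

Lemma sec_pos (v : R) : - (PI / 2) < v < PI / 2 -> 0 < sec v.
Proof. intros Hv. now apply Rinv_0_lt_compat, cos_pos_strip. Qed.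

Lemma LambertW_ordinate_derive_pos (v : R) :
  - (PI / 2) < v < PI / 2 -> 0 < LambertW_ordinate_derive v.
Proof.
  intros Hv. apply Rmult_lt_0_compat; [|apply exp_pos].
  apply Rmult_lt_0_compat; [|now apply sec_pos].
  destruct (Req_dec v 0) as [-> | Hv0].
  - rewrite Rmult_0_l. lra.
  - generalize (pow2_ge_0 (1 + v * tan v)) (pow2_gt_0 v Hv0). lra.
Qed.

Lemma LambertW_ordinate_inj (v w : R) :
  - (PI / 2) < v < PI / 2 -> - (PI / 2) < w < PI / 2 ->
  LambertW_ordinate v = LambertW_ordinate w -> v = w.
Proof.
  assert (M : forall v w, - (PI / 2) < v -> v < w -> w < PI / 2 -> LambertW_ordinate v < LambertW_ordinate w).
  { intros x y Hx Hxy Hy.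
    apply (incr_function LambertW_ordinate (- (PI / 2)) (PI / 2) LambertW_ordinate_derive); auto; simpl.
    - intros t H1 H2. now apply is_derive_LambertW_ordinate.
    - intros t H1 H2. now apply Rlt_gt, LambertW_ordinate_derive_pos. }
  intros Hv Hw E. destruct (Rtotal_order v w) as [H | [H | H]]; [|exact H|].
  - apply M in H; lra.
  - apply M in H; lra.
Qed.

Lemma sec_opp (v : R) : sec (- v) = sec v.
Proof. unfold sec. now rewrite cos_neg. Qed.

Lemma LambertW_ordinate_opp (v : R) : LambertW_ordinate (- v) = - LambertW_ordinate v.
Proof.
  unfold LambertW_ordinate. rewrite tan_neg, sec_opp.
  replace (- v * - tan v) with (v * tan v) by ring. ring.
Qed.

Lemma LambertW_ordinate_derive_opp (v : R) : LambertW_ordinate_derive (- v) = LambertW_ordinate_derive v.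
Proof.
  unfold LambertW_ordinate_derive. rewrite tan_neg, sec_opp.
  replace (- v * - tan v) with (v * tan v) by ring. ring.
Qed.

Lemma LambertW_ordinate_derive_continuous (v : R) :
  - (PI / 2) < v < PI / 2 -> continuous LambertW_ordinate_derive v.
Proof.
  intros Hv. apply cos_pos_strip in Hv. apply (ex_derive_continuous (V := R_NormedModule)).
  unfold LambertW_ordinate_derive, sec, tan. auto_derive. lra.
Qed.

Lemma LambertW_ordinate_continuous (v : R) :
  - (PI / 2) < v < PI / 2 -> continuous LambertW_ordinate v.
Proof.
  intros Hv. apply (ex_derive_continuous (V := R_NormedModule)).
  eexists. now apply is_derive_LambertW_ordinate.
Qed.

Definition LambertW_on_imag (v : R) : C := (v * tan v, v).

(** Write [w = W (i y)].  The vanishing of the real part of [w * Cexp w] reads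
    [Re w = Im w * tan (Im w)]; the imaginary part then says that [y] is the
    ordinate attached to [Im w], and the ordinate is an injective function on
    the strip. *)
Lemma LambertW_imag_axis (v : R) : - (PI / 2) < v < PI / 2 ->
  W (imag_axis (LambertW_ordinate v)) = LambertW_on_imag v.
Proof.
  intros Hv. set (z := imag_axis (LambertW_ordinate v)).
  assert (Hz : 0 <= Re z) by apply Rle_refl.
  assert (Hw := LambertW_Im_bound z Hz).
  destruct (LambertW_parts z (slit_plane_closed_right z Hz)) as [E1 E2].
  assert (Hc := cos_pos_strip _ Hw).
  assert (Eu : Re (W z) = Im (W z) * tan (Im (W z))).
  { assert (He := exp_pos (Re (W z))).
    change (Re z) with 0 in E1. symmetry in E1. apply Rmult_integral in E1 as [E1 | E1]; [lra|].
    unfold tan. apply Rminus_diag_uniq.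
    replace (Re (W z) - Im (W z) * (sin (Im (W z)) / cos (Im (W z))))
      with ((Re (W z) * cos (Im (W z)) - Im (W z) * sin (Im (W z))) / cos (Im (W z)))
      by (field; lra).
    rewrite E1. unfold Rdiv. ring. }
  assert (Ev : Im (W z) = v).
  { apply LambertW_ordinate_inj; try assumption.
    change (Im z) with (LambertW_ordinate v) in E2. rewrite E2, Eu.
    unfold LambertW_ordinate.
    set (w := Im (W z)) in *. set (e := exp (w * tan w)). unfold tan, sec.
    assert (S := sin2_cos2 w). unfold Rsqr in S.
    transitivity (w * / cos w * e * (sin w * sin w + cos w * cos w)).
    - rewrite S. ring.
    - field. lra. }
  rewrite Ev in Eu. unfold LambertW_on_imag. now rewrite (surjective_pairing (W z)), <- Eu, <- Ev at 1.
Qed.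

Lemma imag_square_sum (z : C) (y : R) :
  (z ^ 2 + RtoC (y ^ 2))%C = ((imag_axis y + z) * - (imag_axis y - z))%C.
Proof.
  replace (imag_axis y) with (Ci * RtoC y)%C by (apply injective_projections; simpl; ring).
  replace (RtoC (y ^ 2)) with (- (Ci * Ci) * (RtoC y * RtoC y))%C
    by (apply injective_projections; simpl; ring).
  ring.
Qed.

Lemma imag_square_sum_neq_0 (z : C) (y : R) : 0 < Re z -> (z ^ 2 + RtoC (y ^ 2))%C <> 0.
Proof.
  intros Hz. rewrite imag_square_sum. apply Cmult_neq_0; intros E; apply (f_equal fst) in E;
    unfold Re in Hz; simpl in E; lra.
Qed.

(** Cauchy's formula for [W w / (w + z)]: on the imaginary axis, the factor
    [1 / (w + z)] times the kernel is [- i / (z^2 + y^2)]. *)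
Lemma LambertW_imag_integral (z : C) : 0 < Re z ->
  filterlim (fun r => CInt (fun y => W (imag_axis y) / (z ^ 2 + RtoC (y ^ 2)))%C (- r) r)
    (Rbar_locally p_infty)
    (locally (T := C_UniformSpace) (RtoC PI * (W z / z))%C).
Proof.
  intros Hz. assert (He := Rinv_0_lt_compat _ (exp_pos 1)).
  (* [Re w > - d] keeps [w] off the cut and off the pole [- z] of [1 / (w + z)]. *)
  set (d := Rmin (/ exp 1) (Re z)).
  assert (Hd : 0 < d) by now apply Rmin_pos.
  assert (D1 : forall w, - d < Re w -> - / exp 1 < Re w).
  { intros w Hw. generalize (Rmin_l (/ exp 1) (Re z)). fold d. lra. }
  assert (D2 : forall w, - d < Re w -> (w + z)%C <> 0).
  { intros w Hw E. apply (f_equal Re) in E. change (Re w + Re z = 0) in E.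
    generalize (Rmin_r (/ exp 1) (Re z)). fold d. lra. }
  assert (z0 : z <> 0) by (intros ->; simpl in Hz; lra).
  assert (LIM := half_plane_cauchy_formula d z Hd Hz (fun w => W w * / (w + z))%C
    (fun w => LambertW_derivative w * / (w + z) + W w * (1 * - / ((w + z) * (w + z))))%C).
  cbv beta in LIM.
  assert (F : filterlim (fun r => Ci * CInt (fun y => W (imag_axis y) * / (imag_axis y + z)
      * (Ci / (imag_axis y - z)))%C (- r) r)%C (Rbar_locally p_infty)
      (locally (T := C_UniformSpace) (Ci * (- (Ci * RtoC (2 * PI) * (W z * / (z + z)))))%C)).
  { eapply filterlim_comp; [apply LIM; clear LIM |].
    - intros w Hw. apply (is_Cderive_mult W (fun w => / (w + z))%C).
      + now apply is_Cderive_LambertW, D1.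
      + apply (is_Cderive_comp Cinv (fun w => w + z)%C).
        * now apply is_Cderive_inv, D2.
        * eapply (is_derive_ext (K := C_AbsRing) (V := C_NormedModule)).
          2: apply (is_Cderive_affine (RtoC 1) z).
          intros t. Ceq. ring.
    - intros w Hw.
      assert (C1 : Ccontinuous_map (fun w => w + z)%C w)
        by (apply Ccontinuous_plus; [apply continuous_id | apply continuous_const]).
      apply Ccontinuous_plus; apply Ccontinuous_mult.
      + now apply LambertW_derivative_continuous, D1.
      + apply Ccontinuous_inv; [exact C1 | now apply D2].
      + now apply LambertW_continuous, slit_plane_right, D1.
      + apply Ccontinuous_mult; [apply continuous_const|].
        apply Ccontinuous_opp, Ccontinuous_inv.
        * now apply Ccontinuous_mult.
        * apply Cmult_neq_0; now apply D2.
    - intros eps Heps.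
      (* For such [w], [|w + z| >= |w| / 2], and [|W w| ^ 2 <= 2 |w|] is at most
         [(eps * |w| / 2) ^ 2] because [eps ^ 2 * |w| >= 8]. *)
      exists (Rmax (2 * Cmod z) (8 / eps ^ 2 + 1)). intros w Hw HM.
      assert (M1 := Rle_trans _ _ _ (Rmax_l _ _) HM). assert (M2 := Rle_trans _ _ _ (Rmax_r _ _) HM).
      assert (E2 : 0 < eps ^ 2) by now apply pow_lt.
      assert (P8 : 0 < 8 / eps ^ 2) by (apply Rdiv_lt_0_compat; lra).
      assert (Hwz := Cmod_plus_ge w z). assert (G := LambertW_growth w Hw).
      assert (Cw := Cmod_ge_0 (W w)).
      rewrite Cmod_mult, Cmod_inv by (apply D2; lra).
      apply Rle_div_l; [lra|].
      apply Rle_trans with (eps * (Cmod w / 2)); [|apply Rmult_le_compat_l; lra].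
      apply Rsqr_incr_0_var; [|apply Rmult_le_pos; lra].
      unfold Rsqr. replace (Cmod (W w) * Cmod (W w)) with (Cmod (W w) ^ 2) by ring.
      apply Rle_trans with (1 := G).
      replace (eps * (Cmod w / 2) * (eps * (Cmod w / 2)))
        with (Cmod w * (eps ^ 2 * Cmod w) / 4) by field.
      assert (8 <= eps ^ 2 * Cmod w).
      { rewrite (Rmult_comm (eps ^ 2)). apply Rle_div_l; lra. }
      nra.
    - apply Ccontinuous_mult; [apply continuous_const | apply continuous_id]. }
  assert (Ci2 : (Ci * Ci)%C = (- (1))%C) by (apply injective_projections; simpl; ring).
  assert (E : (Ci * (- (Ci * RtoC (2 * PI) * (W z * / (z + z)))) = RtoC PI * (W z / z))%C).
  { rewrite RtoC_mult. transitivity (- (Ci * Ci) * (RtoC 2 * RtoC PI * (W z * / (z + z))))%C; [ring|].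
    rewrite Ci2. replace (z + z)%C with (RtoC 2 * z)%C by ring. field.
    exact z0. }
  rewrite E in F. revert F. apply filterlim_ext. intros r.
  assert (HL := path_in_imag_axis d z Hd Hz r).
  rewrite <- CInt_mult.
  - apply CInt_ext. intros y _. rewrite imag_square_sum.
    assert (A := D2 (imag_axis y) ltac:(simpl; lra)).
    assert (B : (imag_axis y - z)%C <> 0).
    { intros EB. apply (f_equal fst) in EB. unfold Re in Hz. simpl in EB. lra. }
    Ceq. transitivity (Ci * Ci * (W (imag_axis y) * / (imag_axis y + z) * / (imag_axis y - z)))%C.
    + unfold Cdiv. ring.
    + rewrite Ci2. field. auto.
  - apply (path_integrand_ex_CInt (fun w => - d < Re w) z (fun w => W w * / (w + z))%C
      imag_axis (fun _ => Ci)); [|exact HL].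
    intros w Hw. apply Ccontinuous_mult.
    + now apply LambertW_continuous, slit_plane_right, D1.
    + apply Ccontinuous_inv; [|now apply D2].
      apply Ccontinuous_plus; [apply continuous_id | apply continuous_const].
Qed.

(** * The integral over a compact part of the parameter interval *)

Lemma LambertW_integrand_eq (z : C) (v : R) :
  LambertW_integrand z v =
  (RtoC (LambertW_ordinate_derive v * (v * tan v)) / (z ^ 2 + RtoC (LambertW_ordinate v ^ 2)))%C.
Proof.
  unfold LambertW_integrand.
  replace (v ^ 2 * sec v ^ 2 * exp (2 * v * tan v)) with (LambertW_ordinate v ^ 2).
  - unfold LambertW_ordinate_derive. rewrite !RtoC_mult. unfold Cdiv. ring.
  - unfold LambertW_ordinate.
    replace (2 * v * tan v) with (v * tan v + v * tan v) by ring. rewrite exp_plus. ring.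
Qed.

Lemma LambertW_integrand_continuous (z : C) (v : R) : 0 < Re z ->
  - (PI / 2) < v < PI / 2 -> Ccontinuous (LambertW_integrand z) v.
Proof.
  intros Hz Hv.
  apply (continuous_ext (fun v =>
    RtoC (LambertW_ordinate_derive v * (v * tan v)) / (z ^ 2 + RtoC (LambertW_ordinate v ^ 2)))%C).
  { intros t. symmetry. apply LambertW_integrand_eq. }
  apply Ccontinuous_mult.
  - apply Ccontinuous_RtoC. apply (continuous_mult (K := R_AbsRing)).
    + now apply LambertW_ordinate_derive_continuous.
    + apply cos_pos_strip in Hv. apply (ex_derive_continuous (V := R_NormedModule)).
      unfold tan. auto_derive. lra.
  - apply Ccontinuous_inv; [|now apply imag_square_sum_neq_0].
    apply Ccontinuous_plus; [apply continuous_const|].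
    apply Ccontinuous_RtoC.
    apply (continuous_comp (V := R_UniformSpace) LambertW_ordinate (fun y => y ^ 2)).
    + now apply LambertW_ordinate_continuous.
    + apply (ex_derive_continuous (V := R_NormedModule)). auto_derive. auto.
Qed.

(** In the coordinate [v] the right-hand integrand has the numerator
    [LambertW_ordinate_derive t * (t tan t + i t)]; adding its values at [t] and
    [- t] removes the part [i t] and doubles the other. *)
Lemma LambertW_fold (z : C) (v : R) : 0 < Re z -> 0 < v < PI / 2 ->
  (RtoC 2 * CInt (LambertW_integrand z) 0 v)%C =
  CInt (fun y => W (imag_axis y) / (z ^ 2 + RtoC (y ^ 2)))%C (- LambertW_ordinate v) (LambertW_ordinate v).
Proof.
  intros Hz Hv. set (F y := (W (imag_axis y) / (z ^ 2 + RtoC (y ^ 2)))%C).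
  set (G t := (RtoC (LambertW_ordinate_derive t) *
    (LambertW_on_imag t / (z ^ 2 + RtoC (LambertW_ordinate t ^ 2))))%C).
  assert (Mm : forall t, Rmin (- v) v <= t <= Rmax (- v) v -> - (PI / 2) < t < PI / 2).
  { intros t Ht. rewrite Rmin_left, Rmax_right in Ht; lra. }
  assert (I1 : is_CInt G (- v) v (CInt F (- LambertW_ordinate v) (LambertW_ordinate v))).
  { rewrite <- LambertW_ordinate_opp.
    eapply (is_RInt_ext (V := C_R_NormedModule)).
    2: apply (is_RInt_comp (V := C_R_CompleteNormedModule) F LambertW_ordinate LambertW_ordinate_derive).
    - intros t Ht. assert (Ht' := Mm t ltac:(lra)).
      transitivity (RtoC (LambertW_ordinate_derive t) * F (LambertW_ordinate t))%C; [apply scal_R_Cmult|].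
      unfold F, G. now rewrite LambertW_imag_axis.
    - intros t Ht. apply Ccontinuous_mult.
      + apply (continuous_comp (V := C_UniformSpace) imag_axis W).
        * apply path_continuous with (fun _ => Ci), imag_axis_derive.
        * apply LambertW_continuous, slit_plane_closed_right. simpl. lra.
      + apply Ccontinuous_inv; [|now apply imag_square_sum_neq_0].
        apply Ccontinuous_plus; [apply continuous_const|].
        apply Ccontinuous_RtoC, (ex_derive_continuous (V := R_NormedModule)). auto_derive. auto.
    - intros t Ht. split.
      + now apply is_derive_LambertW_ordinate, Mm.
      + now apply LambertW_ordinate_derive_continuous, Mm. }
  assert (CG : forall t, - (PI / 2) < t < PI / 2 -> Ccontinuous G t).
  { intros t Ht. apply Ccontinuous_mult.
    - now apply Ccontinuous_RtoC, LambertW_ordinate_derive_continuous.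
    - apply Ccontinuous_mult.
      + apply Ccontinuous_pair. split; simpl; [|apply continuous_id].
        apply cos_pos_strip in Ht. apply (ex_derive_continuous (V := R_NormedModule)).
        unfold tan. auto_derive. lra.
      + apply Ccontinuous_inv; [|now apply imag_square_sum_neq_0].
        apply Ccontinuous_plus; [apply continuous_const|].
        apply Ccontinuous_RtoC.
        apply (continuous_comp (V := R_UniformSpace) LambertW_ordinate (fun y => y ^ 2)).
        * now apply LambertW_ordinate_continuous.
        * apply (ex_derive_continuous (V := R_NormedModule)). auto_derive. auto. }
  assert (I2 : is_CInt G (- v) 0 (CInt G (- v) 0)).
  { apply CInt_correct, ex_CInt_continuous. intros t Ht. apply CG, Mm.
    rewrite Rmin_left, Rmax_right in * by lra. lra. }
  assert (I3 : is_CInt G 0 v (CInt G 0 v)).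
  { apply CInt_correct, ex_CInt_continuous. intros t Ht. apply CG, Mm.
    rewrite Rmin_left, Rmax_right in * by lra. lra. }
  assert (I4 := is_RInt_Chasles (V := C_R_NormedModule) _ _ _ _ _ _ I2 I3).
  rewrite <- (is_CInt_unique _ _ _ _ I1), (is_CInt_unique _ _ _ _ I4).
  assert (I5 : is_CInt (fun t => G (- t)) 0 v (CInt G (- v) 0)).
  { rewrite <- Ropp_0 in I2 at 1.
    apply (is_RInt_comp_opp (V := C_R_NormedModule)) in I2.
    apply (is_RInt_swap (V := C_R_NormedModule)) in I2.
    apply (is_RInt_opp (V := C_R_NormedModule)) in I2.
    rewrite opp_opp in I2. revert I2. apply (is_RInt_ext (V := C_R_NormedModule)).
    intros t _. apply opp_opp. }
  assert (I6 := is_RInt_plus (V := C_R_NormedModule) _ _ _ _ _ _ I5 I3).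
  rewrite <- CInt_mult.
  - apply is_CInt_unique. revert I6. apply (is_RInt_ext (V := C_R_NormedModule)).
    intros t _.
    transitivity (G (- t)%R + G t)%C; [reflexivity|]. unfold G.
    rewrite LambertW_ordinate_derive_opp, LambertW_ordinate_opp, LambertW_integrand_eq.
    replace ((- LambertW_ordinate t) ^ 2) with (LambertW_ordinate t ^ 2) by ring.
    set (q := (z ^ 2 + RtoC (LambertW_ordinate t ^ 2))%C).
    rewrite RtoC_mult.
    transitivity (RtoC (LambertW_ordinate_derive t) *
      ((LambertW_on_imag (- t)%R + LambertW_on_imag t) * / q))%C;
      [Ceq; unfold Cdiv; ring|].
    replace (LambertW_on_imag (- t)%R + LambertW_on_imag t)%C with (RtoC 2 * RtoC (t * tan t))%C
      by (apply injective_projections; simpl; rewrite ?tan_neg; ring).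
    Ceq. unfold Cdiv. ring.
  - apply ex_CInt_continuous. intros t Ht. apply LambertW_integrand_continuous; [exact Hz|].
    rewrite Rmin_left, Rmax_right in Ht by lra. lra.
Qed.

(** * The end point PI / 2 *)

Lemma exp_cube_le (u : R) : 0 <= u -> (1 + u) ^ 3 <= 27 * exp u.
Proof.
  intros Hu. replace (exp u) with (exp (u / 3) ^ 3).
  - replace (27 * exp (u / 3) ^ 3) with ((3 * exp (u / 3)) ^ 3) by ring.
    apply pow_incr. generalize (exp_ineq1_le (u / 3)). lra.
  - simpl. rewrite Rmult_1_r, <- !exp_plus. f_equal. field.
Qed.

Lemma tan_nonneg (v : R) : 0 <= v < PI / 2 -> 0 <= tan v.
Proof.
  intros Hv. apply Rdiv_le_0_compat.
  - apply sin_ge_0; lra.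
  - apply cos_pos_strip; lra.
Qed.

Lemma LambertW_ordinate_lower (v : R) : 1 <= v < PI / 2 -> / cos v <= LambertW_ordinate v.
Proof.
  intros Hv. assert (P := PI_RGT_0). assert (Hs : 0 < sec v) by (apply sec_pos; lra).
  assert (Ht := tan_nonneg v ltac:(lra)).
  assert (He : 1 <= exp (v * tan v)).
  { generalize (exp_ineq1_le (v * tan v)) (Rmult_le_pos v (tan v) ltac:(lra) Ht). lra. }
  unfold LambertW_ordinate. fold (sec v).
  rewrite <- (Rmult_1_r (sec v)) at 1.
  apply Rmult_le_compat; nra.
Qed.

(** With [u = v tan v] and [y] the ordinate of [v], the numerator is at most
    [5 (1 + u)^3 e^u sec v], and the denominator is at least [y^2 / 2], of the
    order of [e^(2 u) sec(v)^2].  Since [e^u] dominates [(1 + u)^3], a factor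
    [cos v] is left. *)
Lemma LambertW_integrand_bound (z : C) (v : R) :
  1 <= v < PI / 2 -> cos v * (2 * Cmod z + 1) <= 1 ->
  Cmod (LambertW_integrand z v) <= 270 * cos v.
Proof.
  intros Hv Hc. assert (P := PI_RGT_0). assert (P4 := PI_4).
  assert (Hcos : 0 < cos v) by (apply cos_pos_strip; lra).
  assert (HY := LambertW_ordinate_lower v Hv).
  assert (Ht := tan_nonneg v ltac:(lra)). assert (Cz := Cmod_ge_0 z).
  assert (HzY : 2 * Cmod z + 1 <= LambertW_ordinate v).
  { eapply Rle_trans; [|exact HY]. rewrite <- (Rmult_1_l (/ cos v)).
    apply Rle_div_r; [exact Hcos|]. lra. }
  rewrite LambertW_integrand_eq.
  assert (HD : LambertW_ordinate v ^ 2 / 2 <= Cmod (z ^ 2 + RtoC (LambertW_ordinate v ^ 2))).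
  { rewrite Cplus_comm. eapply Rle_trans; [|apply Cmod_plus_ge].
    rewrite Cmod_R, Cmod_pow, Rabs_right by (apply Rle_ge, pow2_ge_0). nra. }
  assert (HY2 : 0 < LambertW_ordinate v ^ 2) by (apply pow_lt; lra).
  rewrite Cmod_div by (intros E; rewrite E, Cmod_0 in HD; lra).
  assert (Hu : 0 <= v * tan v) by (apply Rmult_le_pos; lra).
  assert (Hd := LambertW_ordinate_derive_pos v ltac:(lra)).
  rewrite Cmod_R, Rabs_right by (apply Rle_ge, Rmult_le_pos; lra).
  apply Rle_div_l; [lra|].
  (* [270 = 2 * 5 * 27], from [y ^ 2 / 2], [v ^ 2 + (1 + u) ^ 2 <= 5 (1 + u) ^ 2]
     and [exp_cube_le]. *)
  apply Rle_trans with (270 * cos v * (LambertW_ordinate v ^ 2 / 2));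
    [|apply Rmult_le_compat_l; lra].
  unfold LambertW_ordinate_derive, LambertW_ordinate, sec.
  set (u := v * tan v) in *. set (c := cos v) in *.
  assert (E3 := exp_cube_le u Hu). assert (E0 := exp_pos u). set (e := exp u) in *.
  replace (270 * c * ((v * / c * e) ^ 2 / 2)) with ((/ c * e) * (v ^ 2 * (135 * e))) by (field; lra).
  replace ((v ^ 2 + (1 + u) ^ 2) * / c * e * u) with ((/ c * e) * ((v ^ 2 + (1 + u) ^ 2) * u)) by ring.
  apply Rmult_le_compat_l; [apply Rmult_le_pos; [left; now apply Rinv_0_lt_compat | lra]|].
  assert (V : 1 <= v ^ 2 <= 4) by nra.
  apply Rle_trans with (5 * (1 + u) ^ 3).
  - replace (5 * (1 + u) ^ 3) with (5 * (1 + u) ^ 2 * (1 + u)) by ring.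
    apply Rmult_le_compat; try lra.
    + generalize (pow2_ge_0 (1 + u)). lra.
    + nra.
  - nra.
Qed.

(** The integrand of the theorem with its limit at [PI / 2], where the formula
    itself only gives the value of a division by zero, and a continuous
    extension beyond, so that continuity at [PI / 2] is two-sided. *)
Definition LambertW_integrand0 (z : C) (v : R) : C :=
  if Rlt_dec v (PI / 2) then LambertW_integrand z v else RtoC 0.

Lemma cos_near_PI2 (eps : R) : 0 < eps -> locally (PI / 2) (fun v => cos v < eps).
Proof.
  intros He. assert (Cc : continuous cos (PI / 2))
    by (apply (ex_derive_continuous (V := R_NormedModule)); auto_derive; auto).
  apply (Cc (fun y => y < eps)). apply open_lt. now rewrite cos_PI2.
Qed.

Lemma near_PI2_gt_1 : locally (PI / 2) (fun v => 1 < v).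
Proof. apply open_gt. generalize PI2_1. lra. Qed.

Lemma LambertW_integrand0_continuous (z : C) (v : R) : 0 < Re z ->
  - (PI / 2) < v -> Ccontinuous (LambertW_integrand0 z) v.
Proof.
  intros Hz Hv. unfold LambertW_integrand0.
  destruct (Rtotal_order v (PI / 2)) as [H | [H | H]].
  - apply (continuous_ext_loc _ (LambertW_integrand z)).
    + generalize (open_lt (PI / 2) v H). apply filter_imp.
      intros t Ht. simpl. now destruct (Rlt_dec t (PI / 2)).
    + now apply LambertW_integrand_continuous.
  - subst v. unfold continuous. destruct (Rlt_dec (PI / 2) (PI / 2)) as [H | _]; [lra|].
    apply Cfilterlim_eps; [apply _|]. intros eps Heps.
    assert (Cz := Cmod_ge_0 z).
    assert (L1 := cos_near_PI2 (eps / 270) ltac:(lra)).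
    assert (L2 := cos_near_PI2 (/ (2 * Cmod z + 1)) ltac:(apply Rinv_0_lt_compat; lra)).
    generalize (filter_and _ _ near_PI2_gt_1 (filter_and _ _ L1 L2)). apply filter_imp.
    intros t [T1 [T2 T3]].
    destruct (Rlt_dec t (PI / 2)) as [Ht | Ht].
    + replace (LambertW_integrand z t - 0)%C with (LambertW_integrand z t) by ring.
      eapply Rle_lt_trans; [apply LambertW_integrand_bound|]; try lra.
      apply Rle_div_r; [lra|]. unfold Rdiv. rewrite Rmult_1_l. lra.
    + replace (0 - 0)%C with (RtoC 0) by ring. rewrite Cmod_0. exact Heps.
  - apply (continuous_ext_loc _ (fun _ => RtoC 0)).
    + generalize (open_gt (PI / 2) v H). apply filter_imp.
      intros t Ht. simpl. destruct (Rlt_dec t (PI / 2)); [lra | reflexivity].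
    + apply continuous_const.
Qed.

Lemma LambertW_ordinate_p_infty :
  filterlim LambertW_ordinate (at_left (PI / 2)) (Rbar_locally p_infty).
Proof.
  intros P [M HM]. unfold filtermap, at_left, within.
  assert (L := cos_near_PI2 (/ (Rmax 1 M)) ltac:(apply Rinv_0_lt_compat; generalize (Rmax_l 1 M); lra)).
  generalize (filter_and _ _ near_PI2_gt_1 L). apply filter_imp.
  intros v [V1 V2] V3. apply HM.
  eapply Rlt_le_trans; [|apply LambertW_ordinate_lower; lra].
  apply Rle_lt_trans with (1 := Rmax_r 1 M).
  assert (P' := PI_RGT_0).
  rewrite <- (Rinv_inv (Rmax 1 M)). apply Rinv_lt_contravar; [|exact V2].
  apply Rmult_lt_0_compat; [apply cos_pos_strip; lra|].
  apply Rinv_0_lt_compat. generalize (Rmax_l 1 M). lra.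
Qed.

(** The integral over [[0, b]] of the continuous extension has two limits as [b]
    tends to [PI / 2] from the left: its value at [PI / 2], by continuity, and
    half of the limit of [LambertW_imag_integral], by [LambertW_fold]. *)
Lemma LambertW_integral (z : C) : 0 < Re z ->
  is_CInt (LambertW_integrand z) 0 (PI / 2) (RtoC (PI / 2) * (W z / z))%C.
Proof.
  intros Hz. assert (P := PI_RGT_0).
  set (g := LambertW_integrand0 z).
  assert (Eg : forall b, 0 <= b <= PI / 2 -> forall t, Rmin 0 b < t < Rmax 0 b ->
    g t = LambertW_integrand z t).
  { intros b Hb t Ht. rewrite Rmin_left, Rmax_right in Ht by lra. unfold g, LambertW_integrand0.
    destruct (Rlt_dec t (PI / 2)); [reflexivity | lra]. }
  assert (Ig : forall b, 0 < b -> is_CInt g 0 b (CInt g 0 b)).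
  { intros b Hb. apply CInt_correct, ex_CInt_continuous. intros t Ht.
    rewrite Rmin_left in Ht by lra. apply LambertW_integrand0_continuous; lra. }
  assert (L1 : filterlim (fun b => CInt g 0 b) (at_left (PI / 2))
    (locally (T := C_UniformSpace) (CInt g 0 (PI / 2)))).
  { apply filterlim_filter_le_1 with (1 := filter_le_within (fun b => b < PI / 2)).
    apply (continuous_RInt_1 (V := C_R_NormedModule) g 0 (PI / 2)).
    generalize near_PI2_gt_1. apply filter_imp. intros b Hb. apply Ig. lra. }
  assert (L2 : filterlim (fun b => CInt g 0 b) (at_left (PI / 2))
    (locally (T := C_UniformSpace) (RtoC (PI / 2) * (W z / z))%C)).
  { apply (filterlim_ext_loc (fun b => RtoC (/ 2) * CInt (fun y => W (imag_axis y) / (z ^ 2 + RtoC (y ^ 2)))%C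
      (- LambertW_ordinate b) (LambertW_ordinate b))%C).
    - unfold at_left, within. generalize near_PI2_gt_1. apply filter_imp. intros b Hb Hb2.
      rewrite <- LambertW_fold by lra. rewrite Cmult_assoc, <- RtoC_mult.
      replace (/ 2 * 2) with 1 by field. rewrite Cmult_1_l.
      symmetry. apply CInt_ext. apply Eg. lra.
    - replace (RtoC (PI / 2) * (W z / z))%C with (RtoC (/ 2) * (RtoC PI * (W z / z)))%C.
      + eapply (filterlim_comp _ _ _ _ (fun w => RtoC (/ 2) * w)%C).
        * eapply (filterlim_comp _ _ _ LambertW_ordinate (fun r => CInt (fun y =>
            W (imag_axis y) / (z ^ 2 + RtoC (y ^ 2)))%C (- r) r)); [apply LambertW_ordinate_p_infty|].
          now apply LambertW_imag_integral.
        * apply Ccontinuous_mult; [apply continuous_const | apply continuous_id].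
      + unfold Rdiv. rewrite RtoC_mult. ring. }
  assert (E := filterlim_locally_unique (V := C_R_NormedModule) _ _ _ L1 L2).
  rewrite <- E.
  apply (is_RInt_ext (V := C_R_NormedModule) g).
  - apply Eg. lra.
  - apply Ig. lra.
Qed.

End LambertW.

(* Coquelicot on the Stdlib reals. C is taken as a normed module over R, so the
   integral is a Riemann integral of a complex-valued function of a real variable. *)
Theorem theorem7p5 :
  forall W : C -> C, is_principal_LambertW W ->
  forall z : C, 0 < Re z ->
    ex_RInt (V := C_R_CompleteNormedModule) (LambertW_integrand z) 0 (PI / 2) /\
    (W z / z)%C =
      (RtoC (2 / PI) *
       RInt (V := C_R_CompleteNormedModule) (LambertW_integrand z) 0 (PI / 2))%C.
Proof.
  intros W HW z Hz. assert (H := LambertW_integral W HW z Hz). split.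
  - eexists. exact H.
  - rewrite (is_CInt_unique _ _ _ _ H), Cmult_assoc, <- RtoC_mult.
    replace (2 / PI * (PI / 2)) with 1 by (field; apply PI_neq0).
    now rewrite Cmult_1_l.
Qed.
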